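(* Let $m>5/2$, $0<T<\infty$, $\alpha\in(-1,\infty)$, and let $v\in C([0,T);H^m(\mathbb{R}^3))$ be a local classical solution of the Euler equations. Suppose there exist $\gamma>1$, $R_1>0$ and $\bar V\in L^2_{\mathrm{loc}}(\mathbb{R}^3)$ such that $$\lim_{t\to T}(T-t)^{(\alpha-\frac32)\frac{\gamma}{\alpha+1}}\left\|v(\cdot,t)-\frac{1}{(T-t)^{\frac{\alpha\gamma}{\alpha+1}}}\bar V\left(\frac{\cdot}{(T-t)^{\frac{\gamma}{\alpha+1}}}\right)\right\|_{L^2(B_{R_1})}=0,$$ where $B_{R_1}=\{x\in\mathbb{R}^3: |x|<R_1\}$. Then $\bar V\in L^2_{\mathrm{loc}}(\mathbb{R}^3)$ is a weak solution of the stationary Euler equations $$(\bar V\cdot\nabla)\bar V=-\nabla\bar P,\qquad \operatorname{div}\bar V=0.$$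
   Context: The 3D incompressible Euler equations are $\partial_t v+(v\cdot\nabla)v=-\nabla p$, $\operatorname{div} v=0$ in $\mathbb{R}^3\times(0,T)$, $v(x,0)=v_0(x)$ with $\operatorname{div}v_0=0$. A field $\bar V\in L^2_{\mathrm{loc}}(\mathbb{R}^3)$ is a weak solution of the stationary Euler equations if $$\int_{\mathbb{R}^3}\bar V\cdot(\bar V\cdot\nabla)\phi\,dy=0$$ for all vector fields $\phi\in C^1_0(\mathbb{R}^3)$ (compactly supported, $C^1$) with $\operatorname{div}\phi=0$, and $$\int_{\mathbb{R}^3}\bar V\cdot\nabla\psi\,dy=0$$ for all scalar functions $\psi\in C^1_0(\mathbb{R}^3)$. *)

(* Defs.v *)
From HB Require Import structures.
From mathcomp Require Import all_boot all_order all_algebra.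
From mathcomp Require Import all_classical all_reals all_analysis.

Set Implicit Arguments.
Unset Strict Implicit.
Unset Printing Implicit Defensive.

Import Order.TTheory GRing.Theory Num.Theory.
Import numFieldNormedType.Exports.

Local Open Scope classical_set_scope.
Local Open Scope ring_scope.

(* R^3 is the iterated product, because 'rV[R]_3 carries no Lebesgue measure
   in the library.  The library norm of the product is the sup norm, hence the
   separate Euclidean norm [enorm] below. *)
Notation R3 R := (R * R * R)%type.

Definition lebesgue3 (R : realType) :
  set (R3 (measurableTypeR R)) -> \bar R :=
  ((@lebesgue_measure R \x @lebesgue_measure R) \x @lebesgue_measure R)%E.

HB.instance Definition _ (R : realType) := Measure.on (@lebesgue3 R).

Section Euclidean.
Context {R : realType}.
Implicit Types x y : R3 R.

Definition coord3 (i : 'I_3) x : R := [:: x.1.1; x.1.2; x.2]`_i.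

Definition vec3 (f : 'I_3 -> R) : R3 R := (f 0, f 1, f 2).

Definition basis3 (j : 'I_3) : R3 R := vec3 (fun i => (i == j)%:R).

Definition dotp x y : R := \sum_i coord3 i x * coord3 i y.

Definition enorm x : R := Num.sqrt (dotp x x).

Definition eball (r : R) : set (R3 R) := [set x | enorm x < r].

End Euclidean.

Section Derivatives.
Context {R : realType}.
Implicit Types (f : R3 R -> R) (u F : R3 R -> R3 R).

Definition partial (j : 'I_3) f (x : R3 R) : R := 'D_(basis3 j) f x.

Definition grad f (x : R3 R) : R3 R := vec3 (fun j => partial j f x).

Definition divergence F (x : R3 R) : R := \sum_i partial i (coord3 i \o F) x.

(* (u . grad) F *)
Definition advect u F (x : R3 R) : R3 R :=
  vec3 (fun i => dotp (u x) (grad (coord3 i \o F) x)).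

Definition C1 f : Prop :=
  forall j, (forall x, derivable f x (basis3 j)) /\ continuous (partial j f).

Definition C1_field F : Prop := forall i, C1 (coord3 i \o F).

Definition C1_0 f : Prop :=
  C1 f /\ compact (closure [set x | f x != 0]).

Definition C1_0_field F : Prop :=
  C1_field F /\ compact (closure [set x | F x != 0]).

End Derivatives.

Section L2.
Context {R : realType}.
Local Notation mu := (@lebesgue3 R).

Definition L2norm (A : set (R3 R)) (F : R3 R -> R3 R) : \bar R :=
  ('N[mu]_2%:E[(fun x => (enorm (F x))%:E) \_ A])%E.

Definition L2loc (F : R3 R -> R3 R) : Prop :=
  measurable_fun setT F /\
  forall K : set (R3 R), compact K -> (L2norm K F < +oo)%E.

End L2.

(* Complex numbers are represented by their real and imaginary parts, so that
   the measurable structure of R * R is available. *)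
Section Sobolev.
Context {R : realType}.
Local Notation mu := (@lebesgue3 R).
Implicit Types (f : R3 R -> R) (g : R3 R -> R * R).

Definition modulus (z : R * R) : R := Num.sqrt (z.1 ^+ 2 + z.2 ^+ 2).

(* (2 pi)^(-3/2) \int_(|x| < r) f(x) e^(- i x . xi) dx *)
Definition fourier_trunc (r : R) f (xi : R3 R) : R * R :=
  ((2 * pi) `^ (- (3 / 2))) *:
    (\int[mu]_(x in eball r) (f x * cos (dotp x xi)),
     - \int[mu]_(x in eball r) (f x * sin (dotp x xi))).

(* Plancherel: the transform of a square integrable f is the limit in L^2 of
   the transforms of its truncations; it is determined almost everywhere. *)
Definition is_fourier f g : Prop :=
  measurable_fun setT g /\
  ('N[mu]_2%:E[(fun xi : R3 R => (modulus (fourier_trunc r f xi - g xi))%:E)])%E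
    @[r --> +oo] --> 0%E.

Definition fourier f : R3 R -> R * R :=
  xget (cst (0, 0)) [set g | is_fourier f g].

Definition sobolev_norm (s : R) f : \bar R :=
  ('N[mu]_2%:E[(fun xi : R3 R =>
     ((1 + enorm xi ^+ 2) `^ (s / 2) * modulus (fourier f xi))%:E)])%E.

(* H^s(R^3), for s >= 0 *)
Definition sobolev (s : R) : set (R3 R -> R) :=
  [set f | f \in Lfun mu 2%:E /\ (sobolev_norm s f < +oo)%E].

(* v belongs to C([0, T); H^s(R^3)), H^s being taken componentwise *)
Definition C_sobolev (s T : R) (v : R -> R3 R -> R3 R) : Prop :=
  forall (i : 'I_3) (t0 : R), 0 <= t0 < T ->
    sobolev s (coord3 i \o v t0) /\
    sobolev_norm s (fun x => coord3 i (v t x) - coord3 i (v t0 x))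
      @[t --> within `[0, T[ (nbhs t0)] --> 0%E.

End Sobolev.

Section Euler.
Context {R : realType}.
Local Notation mu := (@lebesgue3 R).

(* v is of class C^1 on (0, T) x R^3, continuous up to t = 0, and solves the
   equations pointwise for some pressure p; the case t = 0 of the divergence
   condition is the one on the initial datum v 0.  No regularity in time is
   asked of p, which is only determined up to a function of time. *)
Definition euler_classical (T : R) (v : R -> R3 R -> R3 R) : Prop :=
  [/\ {within [set z : R * R3 R | 0 <= z.1 < T],
         continuous (fun z => v z.1 z.2)},
      forall t : R, 0 <= t < T -> C1_field (v t),
      forall i j, {within [set z : R * R3 R | 0 < z.1 < T],
         continuous (fun z => partial j (coord3 i \o v z.1) z.2)},
      (forall (t : R) (x : R3 R), 0 < t < T -> derivable (v ^~ x) t 1) /\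
      {within [set z : R * R3 R | 0 < z.1 < T],
         continuous (fun z => derive1 (v ^~ z.2) z.1)} &
      (forall (t : R) (x : R3 R), 0 <= t < T -> divergence (v t) x = 0) /\
      exists p : R -> R3 R -> R,
        forall t : R, 0 < t < T -> C1 (p t) /\
          forall x, derive1 (v ^~ x) t + advect (v t) (v t) x
                    = - grad (p t) x].

Definition stationary_euler_weak (V : R3 R -> R3 R) : Prop :=
  [/\ L2loc V,
      forall phi : R3 R -> R3 R, C1_0_field phi ->
        (forall x, divergence phi x = 0) ->
        \int[mu]_y dotp (V y) (advect V phi y) = 0 &
      forall psi : R3 R -> R, C1_0 psi ->
        \int[mu]_y dotp (V y) (grad psi y) = 0].

End Euler.

(* Main.v *)
Require Import Defs.
From HB Require Import structures.
From mathcomp Require Import all_boot all_order all_algebra.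
From mathcomp Require Import all_classical all_reals all_analysis.
From mathcomp Require Import measurable_realfun.
From mathcomp Require Import ring lra.
Import Order.TTheory GRing.Theory Num.Theory.
Import numFieldNormedType.Exports.
Set Implicit Arguments.
Unset Strict Implicit.
Unset Printing Implicit Defensive.
Local Open Scope classical_set_scope.
Local Open Scope ring_scope.

(** Write [beta = gamma / (alpha + 1)], [lam t = (T - t) `^ beta] and
    [w t y = (lam t) `^ alpha *: v t (lam t *: y)].  After the change of
    variables [x = lam t *: y] the hypothesis says that the L2 norm of
    [w t - V] over the ball of radius [R1 / lam t] tends to 0 as [t] tends to
    [T].  These balls exhaust the space, so [w t] converges to [V] in L2 on
    every bounded set ([rescaled_L2norm], [L2_close]).

    The divergence condition is linear, and is satisfied by every [w t]; it
    passes to the limit ([weak_mass]).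

    For the momentum equation, fix a solenoidal test field [phi] and let [flux]
    be the integral of [V . (V . grad) phi], which has to vanish.  Nothing
    is known about the time derivative of [w], so the rescaled equation is of no
    use; instead, the test field is frozen at one scale.  For a small [tau], put
    [l0 = tau `^ beta], [Phi x = phi (l0^-1 *: x)], and let [G t] be the
    integral of [v t . Phi].  The Euler equations give that [G' t] is the
    integral of [v t . (v t . grad) Phi], because the pressure disappears
    against a solenoidal field ([is_derive_pairing]).  With [l = lam t] and
    [rho = l / l0], the change of variables turns these into
    [G t = l `^ (3 - alpha) * (integral of w t . phi (rho y))] and
    [G' t = l `^ (3 - 2 alpha) / l0 * (integral of w t . (w t . grad phi)(rho y))]
    ([pairing_rescale], [flux_rescale]).

    Consider [t] between [T - tau] and [T - kap * tau], where [kap < 1] depends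
    on [phi] but not on [tau] and is so close to 1 that [grad phi (rho y)] is
    uniformly close to [grad phi y].  On this interval the integral in [G] is
    bounded ([pairing_bounded]) and, for small [tau], the one in [G'] is within
    [`|flux| / 2] of [flux] ([flux_limit]).  The mean value theorem for [G] then
    gives [(1 - kap) * tau * l0 `^ (2 - 2 alpha) * `|flux| <= C * l0 `^ (3 - alpha)]
    up to a constant, that is, [`|flux| <= C' * tau `^ (gamma - 1)] because
    [l0 `^ (alpha + 1) = tau `^ gamma].  As [gamma > 1], letting [tau] tend to 0
    gives [flux = 0] ([powR_blowup], [weak_momentum]).

    This argument rests on some calculus in R^3: continuous functions are
    measurable for the product sigma-algebra, Lebesgue measure scales by the
    cube of a dilation ratio, functions with continuous partial derivatives are
    continuous, and the divergence of a compactly supported C^1 field has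
    integral zero. *)

(** * Coordinates *)

Section Coordinates.
Context {R : realType}.
Implicit Types x y : R3 R.

Lemma ord3P (P : 'I_3 -> Prop) : P 0 -> P 1 -> P 2 -> forall i, P i.
Proof.
move=> P0 P1 P2 i.
case: (eqVneq i 0) => [->//|i0]; case: (eqVneq i 1) => [->//|i1].
by have -> : i = 2 by case: i i0 i1 => -[|[|[|]]]// i _ _; exact/val_inj.
Qed.

Lemma common_upper3 (P : 'I_3 -> R -> Prop) :
  (forall i K K', K <= K' -> P i K -> P i K') ->
  (forall i, exists2 K, 0 < K & P i K) -> exists2 K, 0 < K & forall i, P i K.
Proof.
move=> mP h; have [K0 h0 P0] := h 0; have [K1 h1 P1] := h 1; have [K2 h2 P2] := h 2.
exists (K0 + K1 + K2); first by rewrite !addr_gt0.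
by apply: ord3P; [apply: mP P0|apply: mP P1|apply: mP P2]; lra.
Qed.

Lemma common_lower3 (c : R) (P : 'I_3 -> R -> Prop) :
  (forall i K K', K' <= K -> P i K -> P i K') ->
  (forall i, exists2 K, 0 < K <= c & P i K) -> exists2 K, 0 < K <= c & forall i, P i K.
Proof.
move=> mP h.
have [K0 /andP[h0 c0] P0] := h 0; have [K1 /andP[h1 c1] P1] := h 1; have [K2 /andP[h2 c2] P2] := h 2.
exists (Num.min K0 (Num.min K1 K2)); first by rewrite !lt_min h0 h1 h2 ge_min c0.
apply: ord3P; [apply: mP P0|apply: mP P1|apply: mP P2];
  by rewrite !ge_min lexx ?orbT.
Qed.

Lemma sum3E (F : 'I_3 -> R) : \sum_i F i = F 0 + F 1 + F 2.
Proof.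
rewrite !big_ord_recl big_ord0 addr0 addrA.
by congr (_ + F _ + F _); exact/val_inj.
Qed.

Lemma coord3_vec3 (F : 'I_3 -> R) i : coord3 i (vec3 F) = F i.
Proof.
by case: i => -[|[|[|]]]// h; rewrite /coord3/=; congr F; exact/val_inj.
Qed.

Lemma coord3_0 i : coord3 i (0 : R3 R) = 0.
Proof. by case: i => -[|[|[|]]]. Qed.

Lemma coord3D i x y : coord3 i (x + y) = coord3 i x + coord3 i y.
Proof. by case: i => -[|[|[|]]]. Qed.

Lemma coord3N i x : coord3 i (- x) = - coord3 i x.
Proof. by case: i => -[|[|[|]]]. Qed.

Lemma coord3B i x y : coord3 i (x - y) = coord3 i x - coord3 i y.
Proof. by case: i => -[|[|[|]]]. Qed.

Lemma coord3Z i (c : R) x : coord3 i (c *: x) = c * coord3 i x.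
Proof. by case: i => -[|[|[|]]]. Qed.

Lemma dotpE x y : dotp x y = x.1.1 * y.1.1 + x.1.2 * y.1.2 + x.2 * y.2.
Proof. by rewrite /dotp sum3E. Qed.

End Coordinates.

(** * Measurability of continuous functions on products *)

(** Rounding [y] down to a multiple of [1 / (n + 1)] makes the function
    constant in [y] on each of countably many slabs, hence measurable;
    continuity in [y] identifies [f] as the limit of these functions. *)
Lemma caratheodory_measurable d (X : measurableType d) (R : realType)
    (f : X * R -> R) :
  (forall y, measurable_fun setT (fun x => f (x, y))) ->
  (forall x, continuous (fun y => f (x, y))) -> measurable_fun setT f.
Proof.
move=> mf cf.
pose q (n : nat) (y : R) : R := (Num.floor (n.+1%:R * y))%:~R / n.+1%:R.
apply: (@measurable_fun_cvg _ _ _ _ (fun n z => f (z.1, q n z.2))); last first.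
  case=> x y _ /=.
  suff qy : q n y @[n --> \oo] --> y.
    exact: (continuous_cvg _ (cf x y) qy).
  apply/cvgrPdist_le => /= e e0; near=> n.
  rewrite /q.
  have n0 : 0 < n.+1%:R :> R by [].
  have -> : y - (Num.floor (n.+1%:R * y))%:~R / n.+1%:R =
    (n.+1%:R * y - (Num.floor (n.+1%:R * y))%:~R) / n.+1%:R.
    by field; rewrite addrC natr1 gt_eqF.
  have := Num.Theory.floor_itv (n.+1%:R * y); rewrite intrD => /andP[h1 h2].
  rewrite ger0_norm ?divr_ge0 ?subr_ge0// ler_pdivrMr//.
  apply: (@le_trans _ _ 1); first by lra.
  rewrite -ler_pdivrMr// div1r ltW//; near: n.
  exact: (near_infty_natSinv_lt (PosNum e0)).
move=> n _ Y mY; rewrite setTI.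
have -> : (fun z => f (z.1, q n z.2)) @^-1` Y =
  \bigcup_(k : int) ([set x | Y (f (x, k%:~R / n.+1%:R))] `*`
    [set y | Num.floor (n.+1%:R * y) = k]).
  apply/seteqP; split => [[x y] /= Yf|[x y] [k _] [/= Yf fk]].
    by exists (Num.floor (n.+1%:R * y)).
  by rewrite /q fk.
apply: countable_bigcupT_measurable; first exact: countableP.
move=> k; apply: measurableX.
  by have := mf (k%:~R / n.+1%:R) measurableT Y mY; rewrite setTI.
have -> : [set y : R | Num.floor (n.+1%:R * y) = k] =
  `[k%:~R / n.+1%:R, (k + 1)%:~R / n.+1%:R[%classic.
  apply/seteqP; split => y /=.
    move=> kE; have := Num.Theory.floor_itv (n.+1%:R * y).
    by rewrite kE in_itv/= ler_pdivrMr// ltr_pdivlMr// !(mulrC _ y).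
  rewrite in_itv/= ler_pdivrMr// ltr_pdivlMr// !(mulrC y).
  exact: floor_def.
exact: measurable_itv.
Unshelve. all: end_near.
Qed.

Lemma continuous_section1 (T U V : topologicalType) (f : T * U -> V) (y : U) :
  continuous f -> continuous (fun x => f (x, y)).
Proof.
move=> cf x; apply: (@continuous_comp _ _ _ (fun x => (x, y)) f); last exact: cf.
by apply: cvg_pair => /=; [exact: cvg_id|exact: cvg_cst].
Qed.

Lemma continuous_section2 (T U V : topologicalType) (f : T * U -> V) (x : T) :
  continuous f -> continuous (fun y => f (x, y)).
Proof.
move=> cf y; apply: (@continuous_comp _ _ _ (fun y => (x, y)) f); last exact: cf.
by apply: cvg_pair => /=; [exact: cvg_cst|exact: cvg_id].
Qed.

Section Measurability.
Context {R : realType}.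
Implicit Types f : R3 R -> R.

Lemma continuous2_measurable (f : R * R -> R) :
  continuous f -> measurable_fun setT f.
Proof.
move=> cf; apply: caratheodory_measurable => [y|x].
  by apply: continuous_measurable_fun; exact: continuous_section1.
exact: continuous_section2.
Qed.

Lemma continuous3_measurable f : continuous f -> measurable_fun setT f.
Proof.
move=> cf; apply: caratheodory_measurable => [z|x].
  by apply: continuous2_measurable; exact: continuous_section1.
exact: continuous_section2.
Qed.

End Measurability.

(** * Lebesgue measure under dilations *)

Section ScaledMeasure.
Context d (T : measurableType d) (R : realType).

(** The change of variables [f] has constant Jacobian [c]. *)
Definition scales_measure (mu : set T -> \bar R) (c : R) (f : T -> T) : Prop :=
  [/\ 0 < c, measurable_fun setT f &
   forall A, measurable A -> mu A = (c%:E * mu (f @^-1` A))%E].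

Lemma scaled_pushforward_measure (mu : {measure set T -> \bar R}) (c : {nonneg R})
    (f : T -> T) : measurable_fun setT f ->
  exists m : {measure set T -> \bar R},
    forall A, m A = (c%:num%:E * mu (f @^-1` A))%E.
Proof.
move=> mf; pose p := measure_function_pushforward__canonical__measure_function_Measure mu mf.
by exists (mscale c p).
Qed.

Variables (mu : {measure set T -> \bar R}) (c : R) (f : T -> T).
Hypothesis sc : scales_measure mu c f.

Lemma ge0_integral_scale (g : T -> \bar R) :
  measurable_fun setT g -> (forall x, 0 <= g x)%E ->
  (\int[mu]_x g x = c%:E * \int[mu]_x g (f x))%E.
Proof.
case: sc => c0 mf muE mg g0.
pose p := measure_function_pushforward__canonical__measure_function_Measure mu mf.
transitivity (\int[mscale (NngNum (ltW c0)) p]_x g x)%E.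
  by apply: eq_measure_integral => //= A mA _; rewrite muE.
rewrite ge0_integral_mscale//=; congr (_ * _)%E.
by rewrite ge0_integral_pushforward.
Qed.

Lemma integral_scale (g : T -> \bar R) :
  measurable_fun setT g -> mu.-integrable setT (g \o f) ->
  (\int[mu]_x g x = c%:E * \int[mu]_x g (f x))%E.
Proof.
move=> mg ig; have [c0 mf muE] := sc.
rewrite -[RHS]/(c%:E * \int[mu]_x (g \o f) x)%E.
rewrite integralE [in RHS]integralE.
rewrite (funepos_comp g f) (funeneg_comp g f).
rewrite (ge0_integral_scale (measurable_funepos mg))//.
rewrite (ge0_integral_scale (measurable_funeneg mg))//.
have := integrable_fin_num measurableT (integrable_funeneg measurableT ig).
rewrite (funeneg_comp g f) => bfin.
by rewrite [RHS]muleBr// fin_num_adde_defl// fin_numN.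
Qed.

Lemma Rintegral_scale (g : T -> R) :
  measurable_fun setT g -> mu.-integrable setT (EFin \o (g \o f)) ->
  \int[mu]_x g x = c * \int[mu]_x g (f x).
Proof.
move=> mg ig; rewrite /Rintegral (@integral_scale (EFin \o g))//=.
  by rewrite fineM//; exact: (integrable_fin_num measurableT ig).
exact/measurable_EFinP.
Qed.

End ScaledMeasure.

(** Both sides of the scaling identity are measures that agree on rectangles,
    and a product of sigma-finite measures is determined by its rectangles. *)
Lemma scales_measure_prod d d' (T : measurableType d) (T' : measurableType d')
    (R : realType) (mu : {sigma_finite_measure set T -> \bar R})
    (nu : {sigma_finite_measure set T' -> \bar R}) (c c' : R) f g :
  scales_measure mu c f -> scales_measure nu c' g ->
  scales_measure (mu \x nu)%E (c * c') (fun x => (f x.1, g x.2)).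
Proof.
move=> [c0 mf muE] [c'0 mg nuE].
have mfg : measurable_fun setT (fun x : T * T' => (f x.1, g x.2)).
  by apply: measurable_fun_pair => /=; apply: measurableT_comp.
split; [exact: mulr_gt0|exact: mfg|move=> A mA].
have [m mE] := scaled_pushforward_measure (mu \x nu)%E (NngNum (ltW (mulr_gt0 c0 c'0))) mfg.
rewrite -mE/=; apply: product_measure_unique => // B B' mB mB'.
rewrite mE muE// nuE//=.
rewrite (_ : _ @^-1` _ = (f @^-1` B) `*` (g @^-1` B'))//.
rewrite product_measure1E; last 2 first.
- by rewrite -[X in measurable X]setTI; exact: mf.
- by rewrite -[X in measurable X]setTI; exact: mg.
by rewrite EFinM muleACA.
Qed.

(** Lebesgue measure is determined by its values on half-open intervals. *)
Lemma lebesgue_measure_scale (R : realType) (c : R) : 0 < c ->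
  scales_measure (@lebesgue_measure R) c ( *%R c : measurableTypeR R -> _).
Proof.
move=> c0; have mf : measurable_fun setT ( *%R c : measurableTypeR R -> measurableTypeR R).
  exact: mulrl_measurable.
split => // A mA.
have [m mE] := scaled_pushforward_measure (@lebesgue_measure R) (NngNum (ltW c0)) mf.
rewrite -mE/=; apply: lebesgue_measure_unique => // _ [[a b]] _ <-.
rewrite mE/=.
have -> : (( *%R c : _ -> measurableTypeR R) @^-1` `]a, b] = `]a / c, b / c])%classic.
  by apply/seteqP; split => x /=; rewrite !in_itv/= ltr_pdivrMr// ler_pdivlMr// mulrC.
rewrite !lebesgue_measure_itv/= !lte_fin ltr_pM2r ?invr_gt0//.
case: ifP => _; last by rewrite mule0.
by rewrite -!EFinB -EFinM; congr EFin; field; rewrite gt_eqF.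
Qed.

(** The product of the first two factors of [lebesgue3], named so that it can carry a sigma-finite
    structure: Fubini and the uniqueness of product measures require one of
    both factors. *)
Definition lebesgue2 (R : realType) :
    set (measurableTypeR R * measurableTypeR R) -> \bar R :=
  (@lebesgue_measure R \x @lebesgue_measure R)%E.

HB.instance Definition _ (R : realType) := Measure.on (@lebesgue2 R).

Lemma lebesgue_itvcc_lty (R : realType) (M : R) :
  (lebesgue_measure [set` `[(- M)%R, M]] < +oo)%E.
Proof. by rewrite lebesgue_measure_itv/=; case: ifP => _; rewrite ?ltry. Qed.

Lemma lebesgue2_sigma_finite (R : realType) : sigma_finite setT (@lebesgue2 R).
Proof.
exists (fun n => `[- n%:R, n%:R]%classic `*` `[- n%:R, n%:R]%classic).
  apply/esym/seteqP; split => // -[x y] _.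
  exists (Num.truncn (Num.max `|x| `|y|)).+1 => //=.
  have := truncnS_gt (Num.max `|x| `|y|); rewrite gt_max => /andP[/ltW xn /ltW yn].
  by rewrite !in_itv/= -!ler_norml.
move=> n; split; first by apply: measurableX; exact: measurable_itv.
rewrite /lebesgue2 product_measure1E; [|exact: measurable_itv..].
by rewrite lte_mul_pinfty// ?ge0_fin_numE// lebesgue_itvcc_lty.
Qed.

HB.instance Definition _ (R : realType) :=
  Measure_isSigmaFinite.Build _ _ _ (@lebesgue2 R) (@lebesgue2_sigma_finite R).

Lemma lebesgue3E (R : realType) :
  @lebesgue3 R = (@lebesgue2 R \x @lebesgue_measure R)%E.
Proof. by []. Qed.

Lemma lebesgue3_scale (R : realType) (c : R) : 0 < c ->
  scales_measure (@lebesgue3 R) (c ^+ 3) (fun x : R3 R => c *: x).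
Proof.
move=> c0; rewrite !exprSr expr0 mul1r.
have h := lebesgue_measure_scale c0.
have h2 : scales_measure (@lebesgue2 R) (c * c) (fun x => (c * x.1, c * x.2)).
  exact: (scales_measure_prod h h).
exact: (scales_measure_prod h2 h).
Qed.

(** * Functions supported in a box *)

Section Box.
Context {R : realType}.
Local Notation mu := (@lebesgue3 R).
Implicit Types (f : R3 R -> R) (x : R3 R) (M : R).

(** The closed cube: the norm of the product is the sup norm.  Supports are
    measured by cubes because these are products, to which Fubini applies. *)
Definition box M : set (R3 R) := [set x | `|x| <= M].

Lemma boxE M : box M = (`[- M, M] `*` `[- M, M]) `*` `[- M, M].
Proof.
apply/seteqP; split => [[[x y] z]|[[x y] z] [[]]] /=;
  rewrite /box /= !prod_normE/= !ge_max !in_itv/= -!ler_norml.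
  by move=> /andP[/andP[]].
by move=> -> -> ->.
Qed.

Lemma compact_box M : compact (box M).
Proof. by rewrite boxE; do !apply: compact_setX; exact: segment_compact. Qed.

Lemma measurable_box M : measurable (box M : set (R3 (measurableTypeR R))).
Proof. by rewrite boxE; do !apply: measurableX; exact: measurable_itv. Qed.

Lemma lebesgue2_square_lty M :
  (@lebesgue2 R ([set` `[(- M)%R, M]] `*` [set` `[(- M)%R, M]]) < +oo)%E.
Proof.
rewrite /lebesgue2 product_measure1E; [|exact: measurable_itv..].
by rewrite lte_mul_pinfty// ?ge0_fin_numE// lebesgue_itvcc_lty.
Qed.

Lemma lebesgue3_box_lty M : (mu (box M) < +oo)%E.
Proof.
rewrite boxE lebesgue3E product_measure1E//; last first.
  by apply: measurableX; exact: measurable_itv.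
have h := lebesgue2_square_lty M.
by rewrite lte_mul_pinfty// ?ge0_fin_numE// lebesgue_itvcc_lty.
Qed.

Lemma open_setC_box M : open (~` box M).
Proof.
apply: closed_openC; apply: compact_closed; last exact: compact_box.
exact: norm_hausdorff.
Qed.

Lemma le_box M N : M <= N -> box M `<=` box N.
Proof. by move=> MN x /le_trans; exact. Qed.

Definition supp_box {V : zmodType} M (f : R3 R -> V) := forall x, ~ box M x -> f x = 0.

Lemma supp_box_le {V : zmodType} M N (f : R3 R -> V) :
  M <= N -> supp_box M f -> supp_box N f.
Proof. by move=> MN fM x xN; apply: fM => /(le_box MN). Qed.

(** The link with the support condition on test functions: a bounded support
    lies in some cube. *)
Lemma compact_supp_box {V : zmodType} (f : R3 R -> V) :
  compact (closure [set x | f x != 0]) -> exists M, 0 < M /\ supp_box M f.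
Proof.
move=> /compact_bounded[M [_ hM]].
exists (`|M| + 1); split; first by rewrite ltr_pwDr.
move=> x; apply: contra_notP => /eqP fx; apply: (hM (`|M| + 1)).
  by rewrite ltr_pwDr// ler_norm.
exact: subset_closure.
Qed.

Lemma continuous_bounded_box f M : continuous f ->
  exists2 K, 0 < K & forall x, box M x -> `|f x| <= K.
Proof.
move=> cf.
have /compact_bounded[K [_ hK]] : compact (f @` box M).
  apply: continuous_compact; [exact: continuous_subspaceT|exact: compact_box].
exists (`|K| + 1); first by rewrite ltr_pwDr.
by move=> x xM; apply: hK; [rewrite ltr_pwDr// ler_norm|exists x].
Qed.

Lemma integrable_box f M K : measurable_fun setT f ->
  (forall x, box M x -> `|f x| <= K) -> mu.-integrable (box M) (EFin \o f).
Proof.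
move=> mf fK; apply: measurable_bounded_integrable.
- exact: measurable_box.
- exact: lebesgue3_box_lty.
- exact: measurable_funTS.
- by exists K; split; [exact: num_real|move=> N /ltW KN x xM /=; exact: le_trans (fK _ xM) KN].
Qed.

Lemma supp_box_patch f M : supp_box M f -> f \_ (box M) = f.
Proof.
move=> fM; apply/funext => x; rewrite patchE; case: ifPn => // xM.
by rewrite fM// => ?; move/negP: xM; apply; rewrite inE.
Qed.

Lemma integrable_supp f M : supp_box M f ->
  mu.-integrable (box M) (EFin \o f) -> mu.-integrable setT (EFin \o f).
Proof.
move=> fM; rewrite (integrable_mkcond _ (measurable_box M)).
by rewrite restrict_EFin (supp_box_patch fM).
Qed.

Lemma Rintegral_supp f M : supp_box M f ->
  \int[mu]_x f x = \int[mu]_(x in box M) f x.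
Proof. by move=> fM; rewrite [RHS]Rintegral_mkcond (supp_box_patch fM). Qed.

Lemma continuous_integrable_box f M : continuous f ->
  mu.-integrable (box M) (EFin \o f).
Proof.
move=> cf; have [K _ hK] := continuous_bounded_box M cf.
exact: (integrable_box (continuous3_measurable cf) hK).
Qed.

Lemma continuous_supp_integrable f M : continuous f -> supp_box M f ->
  mu.-integrable setT (EFin \o f).
Proof. by move=> cf fM; exact: integrable_supp fM (continuous_integrable_box M cf). Qed.

End Box.

(** * Continuity from continuous partial derivatives *)

Section Lines.
Context {R : realType} {V : normedModType R}.
Implicit Types (f : V -> R) (x v : V).

Lemma is_derive_line f x v (s : R) : derivable f (s *: v + x) v ->
  is_derive s 1 (fun t : R => f (t *: v + x)) ('D_v f (s *: v + x)).
Proof.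
set df := 'D_v f _ => dfx.
have E : (fun h : R => h^-1 *: (((fun t : R => f (t *: v + x)) \o shift s) (h *: (1 : R)) -
     f (s *: v + x))) =
     (fun h : R => h^-1 *: ((f \o shift (s *: v + x)) (h *: v) - f (s *: v + x))).
  apply/funext => h /=; congr (_ *: (f _ - _)).
  by rewrite scalerDl addrA /GRing.scale/= mulr1.
by apply: DeriveDef; rewrite /derivable /derive E.
Qed.

(** The mean value inequality along a segment asks for directional
    differentiability on the line only. *)
Lemma line_increment_le f x v (K s : R) :
  (forall t, derivable f (t *: v + x) v) ->
  (forall t, `|t| <= `|s| -> `|'D_v f (t *: v + x)| <= K) ->
  `|f (s *: v + x) - f x| <= K * `|s|.
Proof.
move=> df fK.
pose g (t : R) := f (t *: v + x).
have dg (t : R) : is_derive t 1 g ('D_v f (t *: v + x)) by exact: is_derive_line.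
have cg : continuous g.
  by move=> t; apply: differentiable_continuous; apply/derivable1_diffP; apply: ex_derive; exact: dg.
have -> : f x = g 0 by rewrite /g scale0r add0r.
rewrite -/(g s).
have [s0|s0] := leP 0 s.
  have [c c0s ->] := MVT_segment s0 (fun t _ => dg t) (continuous_subspaceT cg).
  rewrite subr0 normrM ler_wpM2r// fK//; move: c0s; rewrite in_itv/= => /andP[c0 cs].
  by rewrite !ger0_norm.
have [c c0s] := MVT_segment (ltW s0) (fun t _ => dg t) (continuous_subspaceT cg).
rewrite distrC => ->.
rewrite sub0r normrM normrN ler_wpM2r// fK//.
move: c0s; rewrite in_itv/= => /andP[c0 cs].
by rewrite !ler0_norm ?lerN2// ltW.
Qed.

End Lines.

Section C1continuous.
Context {R : realType}.
Implicit Types (f : R3 R -> R) (x : R3 R).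

Lemma scale_basis0 (s : R) : s *: basis3 0 = ((s, 0), 0) :> R3 R.
Proof.
have -> : s *: basis3 0 = ((s * 1, s * 0), s * 0) :> R3 R by [].
by rewrite mulr1 mulr0.
Qed.

Lemma scale_basis1 (s : R) : s *: basis3 1 = ((0, s), 0) :> R3 R.
Proof.
have -> : s *: basis3 1 = ((s * 0, s * 1), s * 0) :> R3 R by [].
by rewrite mulr1 mulr0.
Qed.

Lemma scale_basis2 (s : R) : s *: basis3 2 = ((0, 0), s) :> R3 R.
Proof.
have -> : s *: basis3 2 = ((s * 0, s * 0), s * 1) :> R3 R by [].
by rewrite mulr1 mulr0.
Qed.

Lemma add3E (a b c x y z : R) :
  ((a, b), c) + ((x, y), z) = ((a + x, b + y), c + z) :> R3 R.
Proof. by []. Qed.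

Lemma norm3_lt (x y z r : R) : (`|((x, y), z)| < r) = [&& `|x| < r, `|y| < r & `|z| < r].
Proof. by rewrite !prod_normE/= !gt_max andbA. Qed.

Lemma near_norm3 (a : R3 R) (P : 'I_3 -> R3 R -> Prop) :
  (forall j, \forall x \near a, P j x) ->
  exists2 r : R, 0 < r & forall j x, `|x - a| < r -> P j x.
Proof.
move=> h; have H : \forall x \near a, forall j, P j x := filter_forall (nbhs_filter a) h.
have [r r0 hr] := (proj1 (nbhs_normP _ _) H).
by exists r => // j x xr; apply: hr => //; rewrite /ball_/= distrC.
Qed.

Lemma continuous_at_norm f a :
  (forall e : R, 0 < e -> exists2 d : R, 0 < d &
    forall x, `|x - a| < d -> `|f a - f x| < e) -> {for a, continuous f}.
Proof.
move=> h; apply/cvgrPdist_lt => e /h[d d0 hd].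
have H : \forall x \near a, `|f a - f x| < e.
  apply: (proj2 (nbhs_normP _ _)); exists d => // x.
  by rewrite /ball_ /= distrC; exact: hd.
exact: H.
Qed.

(** The partial derivatives are bounded near [a], and [x] is joined to [a] by
    three segments parallel to the axes that stay near [a]; each of them changes
    [f] by at most a constant times its length. *)
Lemma C1_continuous f : C1 f -> continuous f.
Proof.
move=> Cf a.
have [r r0 [K K0 hK]] : exists2 r : R, 0 < r & exists2 K : R, 0 < K &
    forall j x, `|x - a| < r -> `|partial j f x| <= K.
  have h j : \forall x \near a, `|partial j f x| <= `|partial j f a| + 1.
    have [_ /(_ a) /cvgrPdist_le /(_ _ ltr01)] := Cf j.
    apply: filterS => x h; rewrite -lerBlDl (le_trans _ h)// distrC.
    exact: lerB_dist.
  have [r r0 hr] := near_norm3 h; exists r => //.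
  exists (\sum_j (`|partial j f a| + 1)) => [|j x xr].
    by rewrite big_ord_recl ltr_wpDr ?sumr_ge0// ?ltr_wpDl.
  apply: (@le_trans _ _ (`|partial j f a| + 1)); last first.
    by rewrite (bigD1 j)//= lerDl sumr_ge0.
  exact: hr.
have step (j : 'I_3) (s : R) (y : R3 R) :
    (forall t : R, `|t| <= `|s| -> `|t *: basis3 j + y - a| < r) ->
    `|f (s *: basis3 j + y) - f y| <= K * `|s|.
  move=> yr; apply: line_increment_le => [t|t ts].
    by have [] := Cf j.
  exact/hK/yr.
(* three segments, each contributing less than e / 3 *)
apply: continuous_at_norm => e e0; exists (Num.min r (e / (3 * K))).
  by rewrite /= lt_min r0 divr_gt0// mulr_gt0.
case: a hK step => -[a1 a2] a3 hK step [[x1 x2] x3].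
rewrite lt_min => /andP[].
rewrite !add3E !norm3_lt => /and3P[h1 h2 h3] /and3P[k1 k2 k3].
have e1 : `|f (x1, x2, x3) - f (a1, x2, x3)| <= K * `|x1 - a1|.
  have -> : (x1, x2, x3) = (x1 - a1) *: basis3 0 + (a1, x2, x3) :> R3 R.
    by rewrite scale_basis0 add3E subrK !add0r.
  apply: step => t ts.
  by rewrite scale_basis0 !add3E norm3_lt addrK !add0r h2 h3 (le_lt_trans ts).
have e2 : `|f (a1, x2, x3) - f (a1, a2, x3)| <= K * `|x2 - a2|.
  have -> : (a1, x2, x3) = (x2 - a2) *: basis3 1 + (a1, a2, x3) :> R3 R.
    by rewrite scale_basis1 add3E subrK !add0r.
  apply: step => t ts.
  by rewrite scale_basis1 !add3E norm3_lt !addrK !add0r h3 normr0 r0 (le_lt_trans ts).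
have e3 : `|f (a1, a2, x3) - f (a1, a2, a3)| <= K * `|x3 - a3|.
  have -> : (a1, a2, x3) = (x3 - a3) *: basis3 2 + (a1, a2, a3) :> R3 R.
    by rewrite scale_basis2 add3E subrK !add0r.
  apply: step => t ts.
  by rewrite scale_basis2 !add3E norm3_lt !addrK normr0 r0 (le_lt_trans ts).
have -> : f (a1, a2, a3) - f (x1, x2, x3) = - (f (x1, x2, x3) - f (a1, x2, x3) +
  (f (a1, x2, x3) - f (a1, a2, x3)) + (f (a1, a2, x3) - f (a1, a2, a3))) by ring.
rewrite normrN (le_lt_trans (ler_normD _ _))//.
rewrite (le_lt_trans (lerD (ler_normD _ _) (lexx _)))//.
rewrite (le_lt_trans (lerD (lerD e1 e2) e3))// -!mulrDr.
rewrite mulrC -ltr_pdivlMr//.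
have -> : e / K = e / (3 * K) + e / (3 * K) + e / (3 * K) by field; rewrite gt_eqF.
by rewrite !ltrD.
Qed.

End C1continuous.

(** * Integrals of partial derivatives *)

Section DivergenceTheorem.
Context {R : realType}.
Local Notation mu := (@lebesgue3 R).
Local Notation leb := (@lebesgue_measure R).
Implicit Types (f : R3 R -> R) (x : R3 R) (M : R).

Lemma integral_derivative_eq0 (g dg : R -> R) M :
  (forall s : R, is_derive s 1 g (dg s)) -> continuous dg -> 0 < M ->
  (forall s, M <= `|s| -> g s = 0) -> (forall s, M <= `|s| -> dg s = 0) ->
  (\int[leb]_s (dg s)%:E = 0)%E.
Proof.
move=> dgP cdg M0 g0 dg0.
have cg : continuous g.
  by move=> t; apply: differentiable_continuous; apply/derivable1_diffP; apply: ex_derive; exact: dgP.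
have -> : (\int[leb]_s (dg s)%:E = \int[leb]_(s in `[(- M)%R, M]) (dg s)%:E)%E.
  rewrite [RHS]integral_mkcond; apply: eq_integral => s _.
  rewrite patchE; case: ifPn => // /negP sM; congr EFin; apply: dg0.
  rewrite leNgt; apply/negP => Ms; apply: sM.
  by rewrite inE /= in_itv/= -ler_norml ltW.
rewrite (@continuous_FTC2 _ _ g).
- by rewrite !g0 ?normrN ?ger0_norm// ?ltW// subee.
- by rewrite gtrN.
- exact: continuous_subspaceT.
- split=> [s _||].
  + by apply: ex_derive; exact: dgP.
  + by apply: cvg_at_right_filter; exact: cg.
  + by apply: cvg_at_left_filter; exact: cg.
- by move=> s _; rewrite derive1E; apply: derive_val; exact: dgP.
Qed.

Lemma partial_supp f M j : supp_box M f -> supp_box M (partial j f).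
Proof.
move=> fM x xM; rewrite /partial.
have -> : 'D_(basis3 j) f x = 'D_(basis3 j) (cst 0 : R3 R -> R) x.
  apply: near_eq_derive.
  have h := open_nbhs_nbhs (conj (@open_setC_box R M) xM).
  exact: (filterS _ h).
exact: derive_cst.
Qed.

Lemma notin_box3 M (x y z : R) :
  [|| M < `|x|, M < `|y| | M < `|z|] -> ~ box M ((x, y), z).
Proof.
rewrite /box/= !prod_normE/= !ge_max => h /andP[/andP[hx hy] hz].
by move: h; rewrite !ltNge hx hy hz.
Qed.

Lemma is_derive_slice0 f (x y z : R) : C1 f ->
  is_derive x 1 (fun s : R => f ((s, y), z)) (partial 0 f ((x, y), z)).
Proof.
have E (s : R) : s *: basis3 0 + ((0, y), z) = ((s, y), z) :> R3 R.
  by rewrite scale_basis0 add3E addr0 !add0r.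
move=> Cf; have [df _] := Cf 0.
have -> : (fun s : R => f ((s, y), z)) = (fun s => f (s *: basis3 0 + ((0, y), z))).
  by apply/funext => s; rewrite E.
by rewrite /partial -E; exact: is_derive_line.
Qed.

Lemma is_derive_slice1 f (x y z : R) : C1 f ->
  is_derive y 1 (fun s : R => f ((x, s), z)) (partial 1 f ((x, y), z)).
Proof.
have E (s : R) : s *: basis3 1 + ((x, 0), z) = ((x, s), z) :> R3 R.
  by rewrite scale_basis1 add3E addr0 !add0r.
move=> Cf; have [df _] := Cf 1.
have -> : (fun s : R => f ((x, s), z)) = (fun s => f (s *: basis3 1 + ((x, 0), z))).
  by apply/funext => s; rewrite E.
by rewrite /partial -E; exact: is_derive_line.
Qed.

Lemma is_derive_slice2 f (x y z : R) : C1 f ->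
  is_derive z 1 (fun s : R => f ((x, y), s)) (partial 2 f ((x, y), z)).
Proof.
have E (s : R) : s *: basis3 2 + ((x, y), 0) = ((x, y), s) :> R3 R.
  by rewrite scale_basis2 add3E addr0 !add0r.
move=> Cf; have [df _] := Cf 2.
have -> : (fun s : R => f ((x, y), s)) = (fun s => f (s *: basis3 2 + ((x, y), 0))).
  by apply/funext => s; rewrite E.
by rewrite /partial -E; exact: is_derive_line.
Qed.

Lemma continuous_supp_integrable2 f M (z : R) : continuous f -> supp_box M f ->
  (@lebesgue2 R).-integrable setT (fun p : R * R => (f (p, z))%:E).
Proof.
move=> cf fM.
pose B : set (R * R) := `[- M, M]%classic `*` `[- M, M]%classic.
have mB : measurable (B : set (measurableTypeR R * measurableTypeR R)).
  by apply: measurableX; exact: measurable_itv.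
have [K K0 fK] := continuous_bounded_box M cf.
have iB : (@lebesgue2 R).-integrable B (EFin \o (fun p : R * R => f (p, z))).
  apply: measurable_bounded_integrable => //.
  - exact: lebesgue2_square_lty.
  - apply: measurable_funTS; apply: continuous2_measurable.
    exact: continuous_section1.
  - exists K; split; [exact: num_real|move=> N /ltW KN p _ /=].
    have [pM|/fM ->] := pselect (box M (p, z)); first exact: le_trans (fK _ pM) KN.
    by rewrite normr0 ltW// (lt_le_trans K0).
move: iB; rewrite (integrable_mkcond _ mB) restrict_EFin.
apply: eq_integrable => // -[x y] _ /=.
rewrite patchE; case: ifPn => // /negP xyM.
rewrite fM//; apply: notin_box3.
apply/negP => /negP; rewrite !negb_or -!leNgt => /and3P[hx hy _].
by apply: xyM; rewrite inE; split; rewrite /= in_itv/= -ler_norml.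
Qed.

(** By Fubini, integrate first in the variable that is differentiated: the
    inner integral is that of the derivative of a compactly supported function
    of one variable. *)
Lemma integral_partial0 f M j : C1 f -> 0 < M -> supp_box M f ->
  \int[mu]_x partial j f x = 0.
Proof.
move=> Cf M0 fM.
have cp : continuous (partial j f) by have [] := Cf j.
have pM := partial_supp j fM.
have ip : mu.-integrable setT (EFin \o partial j f) := continuous_supp_integrable cp pM.
(* a point with a coordinate of absolute value M may lie in the box, so the
   slices are only known to vanish from M + 1 on *)
have M1 : 0 < M + 1 by rewrite addr_gt0.
have M1M s : M + 1 <= s -> M < s by apply: lt_le_trans; rewrite ltrDl.
suff : (\int[mu]_x (partial j f x)%:E = 0)%E by rewrite /Rintegral => ->.
rewrite /= in ip; move: ip; rewrite lebesgue3E => ip.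
have [j2|j2] := eqVneq j 2.
  rewrite -(integral12_prod_meas1 ip) integral0_eq// => -[x y] _.
  rewrite /fubini_F.
  apply: (@integral_derivative_eq0 (fun s => f ((x, y), s)) _ (M + 1)) => //.
  - by move=> s; rewrite j2; exact: is_derive_slice2.
  - exact: continuous_section2.
  - by move=> s /M1M Ms; apply: fM; apply: notin_box3; rewrite Ms !orbT.
  - by move=> s /M1M Ms; apply: pM; apply: notin_box3; rewrite Ms !orbT.
rewrite -(integral21_prod_meas1 ip) integral0_eq// => z _.
rewrite /fubini_G.
have ip2 := continuous_supp_integrable2 z cp pM.
have cpz : continuous (fun p => partial j f (p, z)) by exact: continuous_section1.
have [j0|j0] := eqVneq j 0.
  rewrite -(integral21_prod_meas1 ip2) integral0_eq// => y _.
  rewrite /fubini_G.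
  apply: (@integral_derivative_eq0 (fun s => f ((s, y), z)) _ (M + 1)) => //.
  - by move=> s; rewrite j0; exact: is_derive_slice0.
  - exact: (continuous_section1 cpz).
  - by move=> s /M1M Ms; apply: fM; apply: notin_box3; rewrite Ms.
  - by move=> s /M1M Ms; apply: pM; apply: notin_box3; rewrite Ms.
have j1 : j = 1.
  by case: j j0 j2 {cp pM ip ip2 cpz} => -[|[|[|]]]// i _ _; exact/val_inj.
rewrite -(integral12_prod_meas1 ip2) integral0_eq// => x _.
rewrite /fubini_F.
apply: (@integral_derivative_eq0 (fun s => f ((x, s), z)) _ (M + 1)) => //.
- by move=> s; rewrite j1; exact: is_derive_slice1.
- exact: (continuous_section2 cpz).
- by move=> s /M1M Ms; apply: fM; apply: notin_box3; rewrite Ms !orbT.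
- by move=> s /M1M Ms; apply: pM; apply: notin_box3; rewrite Ms !orbT.
Qed.

End DivergenceTheorem.

(** * Integral identities for the Euler equations *)

Section C1Algebra.
Context {R : realType}.
Implicit Types (f g : R3 R -> R) (x : R3 R).

Lemma partialD f g j x : C1 f -> C1 g ->
  partial j (fun y => f y + g y) x = partial j f x + partial j g x.
Proof.
move=> /(_ j)[df _] /(_ j)[dg _].
exact: (@deriveD _ _ _ f g x _ (df x) (dg x)).
Qed.

Lemma C1D f g : C1 f -> C1 g -> C1 (fun y => f y + g y).
Proof.
move=> Cf Cg j; split=> [x|].
  by apply: derivableD; [have [] := Cf j|have [] := Cg j].
have -> : partial j (fun y => f y + g y) = fun x => partial j f x + partial j g x.
  by apply/funext => x; exact: partialD.
by move=> x; apply: cvgD; [have [_] := Cf j; exact|have [_] := Cg j; exact].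
Qed.

Lemma partialM f g j x : C1 f -> C1 g ->
  partial j (fun y => f y * g y) x = partial j f x * g x + f x * partial j g x.
Proof.
move=> /(_ j)[df _] /(_ j)[dg _].
have := @deriveM _ _ f g x _ (df x) (dg x).
rewrite /partial => ->; rewrite addrC; congr (_ + _).
by rewrite mulrC.
Qed.

Lemma C1M f g : C1 f -> C1 g -> C1 (fun y => f y * g y).
Proof.
move=> Cf Cg j; split=> [x|].
  by apply: derivableM; [have [] := Cf j|have [] := Cg j].
have -> : partial j (fun y => f y * g y) =
    fun x => partial j f x * g x + f x * partial j g x.
  by apply/funext => x; exact: partialM.
move=> x; apply: cvgD; apply: cvgM.
- by have [_] := Cf j; exact.
- exact: C1_continuous.
- exact: C1_continuous.
- by have [_] := Cg j; exact.
Qed.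

Lemma dotp_coord (F G : R3 R -> R3 R) : (fun y => dotp (F y) (G y)) = fun x =>
  (coord3 0 \o F) x * (coord3 0 \o G) x + (coord3 1 \o F) x * (coord3 1 \o G) x +
  (coord3 2 \o F) x * (coord3 2 \o G) x.
Proof. by apply/funext => y; rewrite dotpE. Qed.

Lemma C1_dotp (F G : R3 R -> R3 R) : C1_field F -> C1_field G ->
  C1 (fun y => dotp (F y) (G y)).
Proof.
by move=> CF CG; rewrite dotp_coord; apply: C1D; [apply: C1D|]; apply: C1M.
Qed.

Lemma partial_dotp (F G : R3 R -> R3 R) j x : C1_field F -> C1_field G ->
  partial j (fun y => dotp (F y) (G y)) x =
  \sum_i (partial j (coord3 i \o F) x * coord3 i (G x) +
     coord3 i (F x) * partial j (coord3 i \o G) x).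
Proof.
move=> CF CG; rewrite dotp_coord.
rewrite partialD; [|by apply: C1D; apply: C1M|exact: C1M].
rewrite partialD; [|exact: C1M..].
by rewrite !partialM// sum3E.
Qed.

Lemma continuous_dotp (F G : R3 R -> R3 R) :
  (forall i, continuous (coord3 i \o F)) -> (forall i, continuous (coord3 i \o G)) ->
  continuous (fun x => dotp (F x) (G x)).
Proof.
move=> cF cG x.
rewrite dotp_coord.
by apply: cvgD; [apply: cvgD|]; apply: cvgM; first [exact: cF|exact: cG].
Qed.

Lemma advectE (u Phi : R3 R -> R3 R) i x :
  coord3 i (advect u Phi x) = \sum_j coord3 j (u x) * partial j (coord3 i \o Phi) x.
Proof.
by rewrite /advect coord3_vec3 /dotp; apply: eq_bigr => j _; rewrite coord3_vec3.
Qed.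

Lemma continuous_advect (u Phi : R3 R -> R3 R) i :
  (forall i, continuous (coord3 i \o u)) -> C1_field Phi ->
  continuous (coord3 i \o advect u Phi).
Proof.
move=> cu CPhi.
have -> : coord3 i \o advect u Phi =
    fun x => dotp (u x) (grad (coord3 i \o Phi) x).
  by apply/funext => x; rewrite /= /advect coord3_vec3.
apply: continuous_dotp => // j.
have -> : coord3 j \o grad (coord3 i \o Phi) = partial j (coord3 i \o Phi).
  by apply/funext => x; rewrite /= /grad coord3_vec3.
by have [] := CPhi i j.
Qed.

Lemma supp_coord3 M (Phi : R3 R -> R3 R) i : supp_box M Phi -> supp_box M (coord3 i \o Phi).
Proof. by move=> h x /h; rewrite /= => ->; exact: coord3_0. Qed.

Lemma supp_advect M (u Phi : R3 R -> R3 R) : supp_box M Phi ->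
  supp_box M (fun x => dotp (u x) (advect u Phi x)).
Proof.
move=> hM x xM; rewrite /dotp big1// => i _.
rewrite advectE big1 ?mulr0// => j _.
by rewrite (partial_supp _ (supp_coord3 i hM)) ?mulr0.
Qed.

End C1Algebra.

Section Identities.
Context {R : realType}.
Local Notation mu := (@lebesgue3 R).

(** Integrability is part of the conclusion, as the divergence is subtracted
    under the integral sign in the proof of [integral_momentum]. *)
Lemma integral_divergence0 (H : 'I_3 -> R3 R -> R) M :
  (forall j, C1 (H j)) -> 0 < M -> (forall j, supp_box M (H j)) ->
  mu.-integrable setT (fun x => (\sum_j partial j (H j) x)%:E) /\
  \int[mu]_x (\sum_j partial j (H j) x) = 0.
Proof.
move=> CH M0 HM.
have ip j : mu.-integrable setT (EFin \o partial j (H j)).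
  apply: (@continuous_supp_integrable _ _ M); first by have [] := CH j j.
  exact: partial_supp.
have i01 : mu.-integrable setT (EFin \o (fun x => partial 0 (H 0) x + partial 1 (H 1) x)).
  exact: (integrableD measurableT (ip 0) (ip 1)).
split.
  under eq_fun do rewrite sum3E.
  exact: (integrableD measurableT i01 (ip 2)).
under eq_Rintegral do rewrite sum3E.
rewrite (RintegralD measurableT i01 (ip 2)) (RintegralD measurableT (ip 0) (ip 1)).
by rewrite !(integral_partial0 _ (CH _) M0 (HM _)) !addr0.
Qed.

(** The pointwise content of [momentum_identity], with values and derivatives
    as independent variables: [U] is the velocity, [DU i j] its derivative
    [d_j U_i], [P] and [DP] those of the test field, [q] the pressure and [Q]
    its gradient.  The two sides differ by
    [(div U) (U . P) + q (div P)]. *)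
Lemma transport_algebra (U P Q : 'I_3 -> R) (q : R) (DU DP : 'I_3 -> 'I_3 -> R) :
  \sum_i DU i i = 0 -> \sum_i DP i i = 0 ->
  \sum_i (- Q i - \sum_j U j * DU i j) * P i =
  \sum_i U i * (\sum_j U j * DP i j) -
  \sum_j (DU j j * (\sum_i U i * P i) +
    U j * (\sum_i (DU i j * P i + U i * DP i j)) + (Q j * P j + q * DP j j)).
Proof.
move=> du dp; apply/eqP; rewrite -subr_eq0; apply/eqP.
transitivity ((\sum_i DU i i) * (\sum_i U i * P i) + q * (\sum_i DP i i)).
  rewrite !sum3E; clear du dp.
  (* the atoms are generalized so that ring treats them as variables *)
  move: (U 0) (U 1) (U 2) (P 0) (P 1) (P 2) (Q 0) (Q 1) (Q 2).
  move: (DU 0 0) (DU 0 1) (DU 0 2) (DU 1 0) (DU 1 1) (DU 1 2) (DU 2 0) (DU 2 1) (DU 2 2).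
  move: (DP 0 0) (DP 0 1) (DP 0 2) (DP 1 0) (DP 1 1) (DP 1 2) (DP 2 0) (DP 2 1) (DP 2 2).
  by move=> *; ring.
by rewrite du dp mul0r mulr0 addr0.
Qed.

(** Testing the Euler equations against a solenoidal field [Phi]:
    [A . Phi = u . (u . grad) Phi - div ((u . Phi) u + q Phi)], where [A] stands
    for the time derivative of [u]. *)
Lemma momentum_identity (u Phi A : R3 R -> R3 R) (q : R3 R -> R) x :
  C1_field u -> C1 q -> C1_field Phi ->
  divergence u x = 0 -> divergence Phi x = 0 ->
  A x + advect u u x = - grad q x ->
  dotp (A x) (Phi x) = dotp (u x) (advect u Phi x) -
    \sum_j partial j (fun y => coord3 j (u y) * dotp (u y) (Phi y) + q y * coord3 j (Phi y)) x.
Proof.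
move=> Cu Cq CPhi du dPhi euler.
have CS := C1_dotp Cu CPhi; have pS j := partial_dotp j x Cu CPhi.
have E i : coord3 i (A x) = - partial i q x - coord3 i (advect u u x).
  have : coord3 i (A x + advect u u x) = coord3 i (- grad q x) by rewrite euler.
  by rewrite coord3D coord3N /grad coord3_vec3 => <-; rewrite addrK.
have pH j : partial j (fun y => coord3 j (u y) * dotp (u y) (Phi y) + q y * coord3 j (Phi y)) x =
    partial j (coord3 j \o u) x * dotp (u x) (Phi x) +
    coord3 j (u x) * \sum_i (partial j (coord3 i \o u) x * coord3 i (Phi x) +
     coord3 i (u x) * partial j (coord3 i \o Phi) x) +
    (partial j q x * coord3 j (Phi x) + q x * partial j (coord3 j \o Phi) x).
  rewrite (@partialD _ (fun y => coord3 j (u y) * dotp (u y) (Phi y))); last 2 first.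
  - exact: C1M (Cu j) CS.
  - exact: C1M Cq (CPhi j).
  by rewrite (partialM _ _ (Cu j) CS) (partialM _ _ Cq (CPhi j)) pS.
rewrite (eq_bigr _ (fun j _ => pH j)).
rewrite [LHS](eq_bigr (fun i => (- partial i q x -
    \sum_j coord3 j (u x) * partial j (coord3 i \o u) x) * coord3 i (Phi x))); last first.
  by move=> i _; rewrite E advectE.
rewrite [in RHS]/dotp [X in _ = X - _](eq_bigr (fun i => coord3 i (u x) *
  \sum_j coord3 j (u x) * partial j (coord3 i \o Phi) x)); last first.
  by move=> i _; rewrite advectE.
exact: (@transport_algebra (fun i => coord3 i (u x)) (fun i => coord3 i (Phi x))
  (fun i => partial i q x) (q x) (fun i j => partial j (coord3 i \o u) x)
  (fun i j => partial j (coord3 i \o Phi) x) du dPhi).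
Qed.

(** [u . grad psi = div (psi u)] for a solenoidal [u]. *)
Lemma mass_identity (u : R3 R -> R3 R) (psi : R3 R -> R) x :
  C1_field u -> C1 psi -> divergence u x = 0 ->
  dotp (u x) (grad psi x) = \sum_j partial j (fun y => coord3 j (u y) * psi y) x.
Proof.
move=> Cu Cpsi du.
rewrite (eq_bigr (fun j => partial j (coord3 j \o u) x * psi x +
    coord3 j (u x) * partial j psi x)); last first.
  by move=> j _; exact: (partialM j x (Cu j) Cpsi).
rewrite big_split/= -mulr_suml -/(divergence u x) du mul0r add0r.
by rewrite /dotp /grad; apply: eq_bigr => j _; rewrite coord3_vec3.
Qed.

Lemma integral_momentum (u Phi A : R3 R -> R3 R) (q : R3 R -> R) M :
  C1_field u -> C1 q -> C1_field Phi -> 0 < M -> supp_box M Phi ->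
  (forall x, divergence u x = 0) -> (forall x, divergence Phi x = 0) ->
  (forall x, A x + advect u u x = - grad q x) ->
  \int[mu]_x dotp (A x) (Phi x) = \int[mu]_x dotp (u x) (advect u Phi x).
Proof.
move=> Cu Cq CPhi M0 PhiM du dPhi euler.
under eq_Rintegral => x _ do
  rewrite (momentum_identity Cu Cq CPhi (du x) (dPhi x) (euler x)).
have [iH H0] : mu.-integrable setT (fun x => (\sum_j partial j (fun y =>
      coord3 j (u y) * dotp (u y) (Phi y) + q y * coord3 j (Phi y)) x)%:E) /\
   \int[mu]_x (\sum_j partial j (fun y =>
      coord3 j (u y) * dotp (u y) (Phi y) + q y * coord3 j (Phi y)) x) = 0.
  apply: (@integral_divergence0 (fun j y =>
      coord3 j (u y) * dotp (u y) (Phi y) + q y * coord3 j (Phi y)) M) => // j.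
    by apply: C1D; apply: C1M => //; [exact: Cu|exact: C1_dotp|exact: CPhi].
  by move=> x xM; rewrite PhiM// coord3_0 /dotp big1 ?mulr0 ?addr0// => i _; rewrite coord3_0 mulr0.
rewrite RintegralB//.
  by rewrite H0 subr0.
apply: (@continuous_supp_integrable _ _ M); last exact: supp_advect.
by apply: continuous_dotp => i; [exact: C1_continuous|apply: continuous_advect => // j; exact: C1_continuous].
Qed.

Lemma integral_mass (u : R3 R -> R3 R) (psi : R3 R -> R) M :
  C1_field u -> C1 psi -> 0 < M -> supp_box M psi ->
  (forall x, divergence u x = 0) ->
  \int[mu]_x dotp (u x) (grad psi x) = 0.
Proof.
move=> Cu Cpsi M0 psiM du.
under eq_Rintegral => x _ do rewrite (mass_identity Cu Cpsi (du x)).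
apply: (proj2 (@integral_divergence0 (fun j y => coord3 j (u y) * psi y) M _ M0 _)) => j.
  exact: C1M (Cu j) Cpsi.
by move=> x xM; rewrite psiM// mulr0.
Qed.

End Identities.

(** * Time derivative of the momentum pairing *)

Section Pairing.
Context {R : realType}.
Local Notation mu := (@lebesgue3 R).
Implicit Types (x y : R3 R).

Lemma continuous_coord3 (i : 'I_3) : continuous (@coord3 R i).
Proof.
move=> x; case: i => -[|[|[|]]]// h; rewrite /coord3/=.
- by apply: (@continuous_comp _ _ _ fst fst); apply: cvg_fst.
- by apply: (@continuous_comp _ _ _ fst snd); [apply: cvg_fst|apply: cvg_snd].
- exact: cvg_snd.
Qed.

Lemma coord3_le_norm (i : 'I_3) x : `|coord3 i x| <= `|x|.
Proof.
case: x => -[a b] c; rewrite !prod_normE/= !le_max.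
by case: i => -[|[|[|]]]// h; rewrite /coord3/= lexx ?orbT.
Qed.

Lemma dotp_le_norm x y : `|dotp x y| <= 3 * (`|x| * `|y|).
Proof.
rewrite /dotp (le_trans (ler_norm_sum _ _ _))//.
apply: (@le_trans _ _ (\sum_(i < 3) `|x| * `|y|)).
  by apply: ler_sum => i _; rewrite normrM ler_pM// coord3_le_norm.
by rewrite sumr_const card_ord mulr_natl.
Qed.

Lemma norm_le_coord3 x (K : R) : (forall i, `|coord3 i x| <= K) -> `|x| <= K.
Proof.
case: x => -[a b] c h; rewrite !prod_normE/= !ge_max.
by rewrite (h 0) (h 1) (h 2).
Qed.

Lemma field_bounded_box (F : R3 R -> R3 R) (M : R) :
  (forall i, continuous (coord3 i \o F)) ->
  exists2 K, 0 < K & forall x, box M x -> `|F x| <= K.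
Proof.
move=> cF.
have [K K0 hK] : exists2 K, 0 < K & forall i x, box M x -> `|coord3 i (F x)| <= K.
  apply: common_upper3 => [i K K' KK' h x xM|i]; first exact: le_trans (h x xM) KK'.
  exact: (continuous_bounded_box M (cF i)).
by exists K => // x xM; apply: norm_le_coord3 => i; exact: hK.
Qed.

Lemma is_derive_coord3 (g : R -> R3 R) (t : R) i : derivable g t 1 ->
  is_derive t 1 (fun s : R => coord3 i (g s)) (coord3 i (derive1 g t)).
Proof.
move=> dg.
have h : (fun h : R => h^-1 *: ((((fun s : R => coord3 i (g s)) \o shift t) (h *: (1 : R))) - coord3 i (g t)))
   @ 0^' --> coord3 i (derive1 g t).
  have -> : (fun h : R => h^-1 *: ((((fun s : R => coord3 i (g s)) \o shift t) (h *: (1 : R))) - coord3 i (g t)))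
     = coord3 i \o (fun h : R => h^-1 *: ((g \o shift t) (h *: (1 : R)) - g t)).
    by apply/funext => h /=; case: i => -[|[|[|]]].
  apply: cvg_comp; last exact: continuous_coord3.
  by rewrite derive1E; exact: dg.
by apply: DeriveDef; [apply/cvg_ex; eexists; exact: h|exact: cvg_lim h].
Qed.

Lemma is_derive_dotp (g : R -> R3 R) (t : R) (b : R3 R) : derivable g t 1 ->
  is_derive t 1 (fun s : R => dotp (g s) b) (dotp (derive1 g t) b).
Proof.
move=> dg.
have d i := is_derive_coord3 i dg.
have -> : (fun s => dotp (g s) b) = fun s => coord3 0 b *: coord3 0 (g s) +
   coord3 1 b *: coord3 1 (g s) + coord3 2 b *: coord3 2 (g s).
  by apply/funext => s; rewrite /dotp sum3E !(mulrC (coord3 _ (g s))).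
rewrite /dotp sum3E !(mulrC (coord3 _ (derive1 g t))).
exact: is_deriveD.
Qed.

Variables (T : R) (v : R -> R3 R -> R3 R).
Hypothesis ev : euler_classical T v.

(** Joint continuity of the time derivative on a compact space-time box
    provides the dominating constant for differentiation under the integral. *)
Lemma dt_bounded_box (a b M : R) : 0 < a -> b < T ->
  exists2 K, 0 < K & forall s x, a <= s <= b -> box M x ->
    `|derive1 (v ^~ x) s| <= K.
Proof.
move=> a0 bT; case: ev => _ _ _ [_ cdt] _.
pose A : set (R * R3 R) := `[a, b]%classic `*` box M.
have cA : compact A by apply: compact_setX; [exact: segment_compact|exact: compact_box].
have /compact_bounded[K [_ hK]] : compact ((fun z : R * R3 R => derive1 (v ^~ z.2) z.1) @` A).
  apply: continuous_compact cA; apply: continuous_subspaceW cdt.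
  move=> [s x] [/=]; rewrite in_itv/= => /andP[as_ sb] _.
  by rewrite (lt_le_trans a0)// (le_lt_trans sb).
exists (`|K| + 1); first by rewrite ltr_pwDr.
move=> s x sab xM; apply: hK; first by rewrite ltr_pwDr// ler_norm.
by exists (s, x) => //; split => //=; rewrite in_itv.
Qed.

(** Differentiation under the integral sign, then [integral_momentum].  The
    pressure enters through the latter, at the single time [t]. *)
Lemma is_derive_pairing (Phi : R3 R -> R3 R) (M t : R) :
  C1_field Phi -> 0 < M -> supp_box M Phi -> (forall x, divergence Phi x = 0) ->
  0 < t < T ->
  is_derive t 1 (fun s : R => \int[mu]_x dotp (v s x) (Phi x))
    (\int[mu]_x dotp (v t x) (advect (v t) Phi x)).
Proof.
move=> CPhi M0 PhiM dPhi /andP[t0 tT].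
have [_ Cv _ [dv _] [divv [p eqs]]] := ev.
have fM s : supp_box M (fun x => dotp (v s x) (Phi x)).
  by move=> x xM; rewrite PhiM// /dotp big1// => i _; rewrite coord3_0 mulr0.
pose a := t / 2; pose b := (t + T) / 2.
have a0 : 0 < a by rewrite divr_gt0.
have bT : b < T by rewrite /b; lra.
have tab : `]a, b[%classic t by rewrite /= in_itv/= /a /b; apply/andP; split; lra.
have I0T s : `]a, b[%classic s -> 0 < s < T.
  by rewrite /= in_itv/= => /andP[h1 h2]; rewrite (lt_trans a0)// (lt_trans h2).
have [K K0 hK] := dt_bounded_box M a0 bT.
have [K' K'0 hK'] := field_bounded_box M (fun i => C1_continuous (CPhi i)).
pose f s x := dotp (v s x) (Phi x).
have df s x : 0 < s < T -> is_derive s 1 (f ^~ x) (dotp (derive1 (v ^~ x) s) (Phi x)).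
  by move=> s0T; apply: (is_derive_dotp (Phi x)); exact: dv.
have intf s : `]a, b[%classic s -> mu.-integrable (box M) (EFin \o f s).
  move=> /I0T/andP[s0 sT]; apply: continuous_integrable_box.
  apply: continuous_dotp => i; apply: C1_continuous => //.
  by apply: Cv; rewrite ltW.
pose G := fun _ : R3 R => 3 * (K * K').
have intG : mu.-integrable (box M) (EFin \o G).
  by apply: continuous_integrable_box => x; exact: cvg_cst.
have derf s x : `]a, b[%classic s -> box M x -> derivable (f ^~ x) s 1.
  by move=> /I0T s0T _; apply: ex_derive; exact: df.
have G0 x : 0 <= G x by rewrite /G !mulr_ge0// ltW.
have Gub s x : `]a, b[%classic s -> box M x -> `|partial1of2 f s x| <= G x.
  move=> sab xM; rewrite partial1of2E.
  have -> : 'D_1 (f ^~ x) s = dotp (derive1 (v ^~ x) s) (Phi x).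
    by apply: derive_val; apply: df; exact: I0T.
  rewrite (le_trans (dotp_le_norm _ _))// ler_wpM2l// ler_pM//; last exact: hK'.
  by apply: hK => //; move: sab; rewrite /= in_itv/= => /andP[/ltW -> /ltW ->].
have dF := derivable_under_integral (measurable_box M) tab intf derf G0 intG Gub.
have DF := differentiation_under_integral (measurable_box M) tab intf derf G0 intG Gub.
have -> : (fun s : R => \int[mu]_x dotp (v s x) (Phi x)) =
  (fun s => \int[mu]_(x in box M) f s x).
  by apply/funext => s; rewrite (Rintegral_supp (fM s)).
have t0T : 0 < t < T by rewrite t0.
apply: DeriveDef; first exact: dF.
rewrite -derive1E DF.
have [Cp eq_t] := eqs t t0T.
have Cvt : C1_field (v t) by apply: Cv; rewrite ltW.
have dvt x : divergence (v t) x = 0 by apply: divv; rewrite ltW.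
rewrite -(integral_momentum Cvt Cp CPhi M0 PhiM dvt dPhi eq_t).
rewrite (@Rintegral_supp _ _ M); last first.
  by move=> x xM; rewrite PhiM// /dotp big1// => i _; rewrite coord3_0 mulr0.
apply: eq_Rintegral => x _ /=.
by rewrite partial1of2E; apply: derive_val; exact: df.
Qed.

End Pairing.

(** * The square of the L2 norm *)

Section SquareNorm.
Context {R : realType}.
Local Notation mu := (@lebesgue3 R).
Implicit Types (x y : R3 R).

Lemma dotp_ge0 x : 0 <= dotp x x.
Proof. by rewrite /dotp sumr_ge0// => i _; rewrite -expr2 sqr_ge0. Qed.

Lemma dotpZ (c : R) x : dotp (c *: x) (c *: x) = c ^+ 2 * dotp x x.
Proof.
rewrite /dotp mulr_sumr; apply: eq_bigr => i _.
by rewrite coord3Z expr2; ring.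
Qed.

Lemma enormZ (c : R) x : 0 <= c -> enorm (c *: x) = c * enorm x.
Proof. by move=> c0; rewrite /enorm dotpZ sqrtrM ?sqr_ge0// sqrtr_sqr ger0_norm. Qed.

Lemma enorm_le_norm x : enorm x <= 2 * `|x|.
Proof.
rewrite /enorm -[leRHS]ger0_norm ?mulr_ge0// -sqrtr_sqr ler_sqrt ?sqr_ge0//.
apply: (@le_trans _ _ (3 * `|x| ^+ 2)).
  rewrite /dotp (_ : 3 * _ = \sum_(i < 3) `|x| ^+ 2); last by rewrite sumr_const card_ord mulr_natl.
  apply: ler_sum => i _; rewrite -expr2 -real_normK ?num_real//.
  by rewrite lerXn2r ?nnegrE// coord3_le_norm.
by rewrite exprMn ler_wpM2r ?sqr_ge0// -natrX ler_nat.
Qed.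

Lemma measurable_coord3 i (F : R3 R -> R3 R) :
  measurable_fun setT F -> measurable_fun setT (coord3 i \o F).
Proof.
move=> mF; case: i => -[|[|[|]]]// h; rewrite /coord3/=.
- by apply: (measurableT_comp measurable_fst); apply: (measurableT_comp measurable_fst).
- by apply: (measurableT_comp measurable_snd); apply: (measurableT_comp measurable_fst).
- by apply: (measurableT_comp measurable_snd).
Qed.

Lemma measurable_dotp (F G : R3 R -> R3 R) :
  (forall i, measurable_fun setT (coord3 i \o F)) ->
  (forall i, measurable_fun setT (coord3 i \o G)) ->
  measurable_fun setT (fun x => dotp (F x) (G x)).
Proof.
move=> mF mG; rewrite dotp_coord.
by apply: measurable_funD; [apply: measurable_funD|]; apply: measurable_funM.
Qed.

Lemma measurable_eball (r : R) : measurable (eball r : set (R3 (measurableTypeR R))).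
Proof.
have mE : measurable_fun setT (@enorm R).
  apply: (measurableT_comp (f := @Num.sqrt R)).
    by apply: continuous_measurable_fun; exact: sqrt_continuous.
  by apply: (@measurable_dotp idfun idfun) => i; apply: continuous3_measurable; exact: continuous_coord3.
have := mE measurableT `]-oo, r[%classic (measurable_itv _); rewrite setTI.
by congr measurable; apply/seteqP; split => x /=; rewrite in_itv.
Qed.

Lemma L2norm_sqr (A : set (R3 R)) (F : R3 R -> R3 R) :
  (L2norm A F `^ 2 = \int[mu]_(x in A) (dotp (F x) (F x))%:E)%E.
Proof.
rewrite /L2norm poweR_Lnorm// [RHS]integral_mkcond; apply: eq_integral => x _.
rewrite !patchE; case: ifPn => _; last by rewrite abse0 poweR0r.
rewrite abse_EFin poweR_EFin powR_mulrn// -normrX ger0_norm ?sqr_ge0//.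
by rewrite /enorm sqr_sqrtr// dotp_ge0.
Qed.

End SquareNorm.

(** * Self-similar rescaling *)

Section Rescaling.
Context {R : realType}.
Local Notation mu := (@lebesgue3 R).
Implicit Types (x y : R3 R) (u V : R3 R -> R3 R).

Definition rescale (alpha l : R) u : R3 R -> R3 R := fun y => l `^ alpha *: u (l *: y).

(** The exponent [alpha - 3 / 2] is what makes the weighted norm invariant: its
    square contributes [l `^ (2 alpha - 3)], the change of variables [l ^+ 3],
    and their product is the factor [l `^ (2 alpha)] absorbed by [rescale]. *)
Lemma rescaled_L2norm (alpha l R1 : R) u V : 0 < l ->
  measurable_fun setT u -> measurable_fun setT V ->
  (((l `^ (alpha - 3 / 2))%:E * L2norm (eball R1)
      (fun x => u x - (l `^ alpha)^-1 *: V (l^-1 *: x))%R) `^ 2 =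
  \int[mu]_(y in eball (R1 / l))
    (dotp (rescale alpha l u y - V y) (rescale alpha l u y - V y))%:E)%E.
Proof.
move=> l0 mu_ mV.
have la0 : 0 < l `^ alpha by rewrite powR_gt0.
rewrite poweRM ?Lnorm_ge0 ?lee_fin ?powR_ge0// L2norm_sqr poweR_EFin.
rewrite integral_mkcond [RHS]integral_mkcond.
pose D x := u x - (l `^ alpha)^-1 *: V (l^-1 *: x).
have mD : measurable_fun setT (fun x => dotp (D x) (D x)).
  have h i : measurable_fun setT (coord3 i \o D).
    have -> : coord3 i \o D = (coord3 i \o u) \-
        (fun x => (l `^ alpha)^-1 * (coord3 i \o V) (l^-1 *: x)).
      by apply/funext => x; rewrite /D/= coord3B coord3Z.
    apply: measurable_funB; first exact: measurable_coord3.
    apply: measurable_funM => //.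
    have linv0 : 0 < l^-1 by rewrite invr_gt0.
    have [_ ms _] := lebesgue3_scale linv0.
    exact: measurableT_comp (measurable_coord3 i mV) ms.
  exact: measurable_dotp.
pose g := (fun x => (dotp (D x) (D x))%:E) \_ (eball R1).
have mg : measurable_fun setT g.
  apply/(measurable_restrictT _ (measurable_eball _)).
  by apply: measurable_funTS; exact/measurable_EFinP.
have g0 x : (0 <= g x)%E.
  by rewrite /g patchE; case: ifPn => // _; rewrite lee_fin dotp_ge0.
have [_ msl _] := lebesgue3_scale l0.
rewrite -[X in (_ * X = _)%E]/(\int[mu]_x g x)%E.
rewrite (ge0_integral_scale (lebesgue3_scale l0) mg g0).
have lE : (l `^ (alpha - 3 / 2)) `^ 2 * l ^+ 3 = (l `^ alpha) ^+ 2.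
  have -> : l ^+ 3 = l `^ 3 by rewrite powR_mulrn// ltW.
  rewrite -powRrM -powRD; last by rewrite (gt_eqF l0); case: (_ == _).
  rewrite -powR_mulrn ?powR_ge0// -powRrM; congr powR; by field.
rewrite muleA -EFinM lE.
rewrite -ge0_integralZl_EFin ?sqr_ge0//; last exact: measurableT_comp mg msl.
apply: eq_integral => y _; rewrite /g !patchE.
have -> : (l *: y \in eball R1) = (y \in eball (R1 / l)).
  by apply/idP/idP; rewrite !inE /eball/= enormZ ?ltW// ltr_pdivlMr// mulrC.
case: ifPn => _; last by rewrite mule0.
rewrite -EFinM; congr EFin.
rewrite -dotpZ /D /rescale; congr (dotp _ _);
  by rewrite scalerBr !scalerA mulfV ?gt_eqF// mulVf ?gt_eqF// !scale1r.
Qed.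
End Rescaling.

(** * Stability of quadratic forms *)

Section Forms.
Context {R : realType}.
Local Notation mu := (@lebesgue3 R).
Implicit Types (x y a d : R3 R) (w V : R3 R -> R3 R).

(** With [B i j = d_j phi_i] this is [a . (a . grad) phi]. *)
Definition qform a (B : 'I_3 -> 'I_3 -> R) : R :=
  \sum_i coord3 i a * \sum_j coord3 j a * B i j.

Lemma sqr_coord3_le i a : coord3 i a ^+ 2 <= dotp a a.
Proof.
rewrite /dotp (bigD1 i)//= -expr2 lerDl sumr_ge0// => j _.
by rewrite -expr2 sqr_ge0.
Qed.

(** The squares are replaced by upper bounds [P] and [Q] because [p] and [q]
    will be coordinates of vectors whose squared lengths are controlled. *)
Lemma young (p q P Q eta : R) : 0 < eta -> p ^+ 2 <= P -> q ^+ 2 <= Q ->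
  `|p * q| <= (eta * P + Q / eta) / 2.
Proof.
move=> e0 pP qQ.
have h : `|p * q| <= (eta * p ^+ 2 + q ^+ 2 / eta) / 2.
  have -> : q ^+ 2 / eta = eta * (q / eta) ^+ 2 by field; rewrite gt_eqF.
  have -> : p * q = eta * (p * (q / eta)) by field; rewrite gt_eqF.
  move: (q / eta) => r; rewrite normrM gtr0_norm// normrM.
  rewrite -(real_normK (num_real p)) -(real_normK (num_real r)).
  rewrite -mulrDr -mulrA ler_pM2l// ler_pdivlMr//.
  rewrite -subr_ge0 (_ : _ - _ = (`|p| - `|r|) ^+ 2) ?sqr_ge0//; ring.
apply: (le_trans h); rewrite ler_pM2r// lerD//; first by rewrite ler_wpM2l// ltW.
by rewrite ler_wpM2r// invr_ge0 ltW.
Qed.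

(** The error is split so that after integration each part can be made small:
    [dotp a a] is multiplied by [K * eta + om], where [eta] is free and [om]
    measures the change of coefficients, whereas the large factor [1 / eta]
    goes with [dotp d d], whose integral tends to 0.  The constant 9 counts the
    pairs of indices. *)
Lemma qform_diff_le a d (B B' : 'I_3 -> 'I_3 -> R) (K om eta : R) :
  0 < eta -> eta <= 1 -> 0 <= K ->
  (forall i j, `|B' i j| <= K) -> (forall i j, `|B' i j - B i j| <= om) ->
  `|qform (a + d) B' - qform a B| <=
  9 * (K * eta + om) * dotp a a + 9 * (2 * K / eta) * dotp d d.
Proof.
move=> e0 e1 K0 B'K B'B.
have E : qform (a + d) B' - qform a B = \sum_i \sum_j
   ((coord3 i a * coord3 j d + coord3 i d * coord3 j a + coord3 i d * coord3 j d) * B' i j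
    + coord3 i a * coord3 j a * (B' i j - B i j)).
  rewrite /qform -sumrB; apply: eq_bigr => i _.
  rewrite !mulr_sumr -sumrB; apply: eq_bigr => j _.
  by rewrite !coord3D; ring.
rewrite E.
have term i j : `|(coord3 i a * coord3 j d + coord3 i d * coord3 j a + coord3 i d * coord3 j d) * B' i j
    + coord3 i a * coord3 j a * (B' i j - B i j)| <=
    (K * eta + om) * dotp a a + (2 * K / eta) * dotp d d.
  have h1 := young e0 (sqr_coord3_le i a) (sqr_coord3_le j d).
  have h2 := young e0 (sqr_coord3_le j a) (sqr_coord3_le i d).
  have h3 := young ltr01 (sqr_coord3_le i d) (sqr_coord3_le j d).
  have h4 := young ltr01 (sqr_coord3_le i a) (sqr_coord3_le j a).
  rewrite divr1 mul1r in h3; rewrite divr1 mul1r in h4.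
  have dd : dotp d d <= dotp d d / eta.
    by rewrite ler_pdivlMr// ler_piMr// dotp_ge0.
  have om0 : 0 <= om by apply: le_trans (B'B i j).
  have s1 : `|coord3 i a * coord3 j d + coord3 i d * coord3 j a + coord3 i d * coord3 j d| <=
     eta * dotp a a + 2 * (dotp d d / eta).
    rewrite (le_trans (ler_normD _ _))// (le_trans (lerD (ler_normD _ _) (lexx _)))//.
    rewrite (mulrC (coord3 i d) (coord3 j a)).
    lra.
  have s2 : `|coord3 i a * coord3 j a| <= dotp a a by lra.
  have p1 := ler_pM (normr_ge0 _) (normr_ge0 _) s1 (B'K i j).
  have p2 := ler_pM (normr_ge0 _) (normr_ge0 _) s2 (B'B i j).
  rewrite -normrM in p1; rewrite -normrM in p2.
  apply: (le_trans (ler_normD _ _)); apply: (le_trans (lerD p1 p2)).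
  by rewrite le_eqVlt; apply/orP; left; apply/eqP; ring.
apply: (@le_trans _ _ (\sum_(i < 3) \sum_(j < 3)
    ((K * eta + om) * dotp a a + (2 * K / eta) * dotp d d))).
  rewrite (le_trans (ler_norm_sum _ _ _))//; apply: ler_sum => i _.
  rewrite (le_trans (ler_norm_sum _ _ _))//; apply: ler_sum => j _.
  exact: term.
rewrite !sumr_const !card_ord -mulrnA -mulr_natl.
by rewrite le_eqVlt; apply/orP; left; apply/eqP; ring.
Qed.

End Forms.

(** * Stability of integrals of linear and quadratic forms *)

Section FormIntegrals.
Context {R : realType}.
Local Notation mu := (@lebesgue3 R).
Implicit Types (x y a d : R3 R).

Definition sqnorm (F : R3 R -> R3 R) (y : R3 R) : R := dotp (F y) (F y).

Lemma qform_le a (B : 'I_3 -> 'I_3 -> R) (K : R) : 0 <= K ->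
  (forall i j, `|B i j| <= K) -> `|qform a B| <= 18 * K * dotp a a.
Proof.
move=> K0 BK.
have h := @qform_diff_le _ a 0 (fun _ _ => 0) B K K 1 ltr01 (lexx _) K0 BK.
have q0 : qform a (fun _ _ => 0) = 0.
  by rewrite /qform big1// => i _; rewrite big1 ?mulr0// => j _; rewrite mulr0.
have d0 : dotp 0 0 = 0 :> R by rewrite /dotp big1// => i _; rewrite coord3_0 mulr0.
rewrite addr0 q0 subr0 d0 mulr0 addr0 in h.
apply: le_trans (h _) _; first by move=> i j; rewrite subr0.
by rewrite le_eqVlt; apply/orP; left; apply/eqP; ring.
Qed.

Lemma dotpD_le a d : dotp (a + d) (a + d) <= 2 * dotp a a + 2 * dotp d d.
Proof.
rewrite /dotp !mulr_sumr -big_split/=; apply: ler_sum => i _; rewrite coord3D.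
rewrite -subr_ge0 (_ : _ - _ = (coord3 i a - coord3 i d) ^+ 2) ?sqr_ge0//; ring.
Qed.

(** [3 * K * eta / 2] is multiplied by the volume of a box after integration,
    and is small with [eta]; see [linear_form_close]. *)
Lemma dotp_young a (g : R3 R) (K eta : R) : 0 < eta -> 0 <= K ->
  (forall i, `|coord3 i g| <= K) ->
  `|dotp a g| <= 3 * K * eta / 2 + 3 * K / (2 * eta) * dotp a a.
Proof.
move=> e0 K0 gK.
rewrite /dotp (le_trans (ler_norm_sum _ _ _))// -/(dotp a a).
apply: (@le_trans _ _ (\sum_(i < 3) (eta + dotp a a / eta) / 2 * K)).
  apply: ler_sum => i _; rewrite normrM ler_pM//.
  have := @young _ 1 (coord3 i a) 1 (dotp a a) eta e0.
  by rewrite expr1n mul1r mulr1; apply => //; exact: sqr_coord3_le.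
rewrite sumr_const card_ord -mulr_natl.
by rewrite le_eqVlt; apply/orP; left; apply/eqP; field; rewrite gt_eqF.
Qed.

Lemma measurable_qform (F : R3 R -> R3 R) (A : 'I_3 -> 'I_3 -> R3 R -> R) :
  (forall i, measurable_fun setT (coord3 i \o F)) ->
  (forall i j, measurable_fun setT (A i j)) ->
  measurable_fun setT (fun y => qform (F y) (fun i j => A i j y)).
Proof.
move=> mF mA.
have mS i : measurable_fun setT (fun y => \sum_j coord3 j (F y) * A i j y).
  rewrite (_ : (fun y => _) = fun y => coord3 0 (F y) * A i 0 y +
     coord3 1 (F y) * A i 1 y + coord3 2 (F y) * A i 2 y); last first.
    by apply/funext => y; rewrite sum3E.
  by apply: measurable_funD; [apply: measurable_funD|]; apply: measurable_funM => //; exact: mF.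
rewrite (_ : (fun y => _) = fun y => coord3 0 (F y) * (\sum_j coord3 j (F y) * A 0 j y) +
   coord3 1 (F y) * (\sum_j coord3 j (F y) * A 1 j y) +
   coord3 2 (F y) * (\sum_j coord3 j (F y) * A 2 j y)); last first.
  by apply/funext => y; rewrite /qform sum3E.
by apply: measurable_funD; [apply: measurable_funD|]; apply: measurable_funM => //; exact: mF.
Qed.

Lemma sqnorm_integrable (F : R3 R -> R3 R) (N : R) :
  (forall i, measurable_fun setT (coord3 i \o F)) ->
  (\int[mu]_(y in box N) (sqnorm F y)%:E < +oo)%E ->
  mu.-integrable (box N) (EFin \o sqnorm F).
Proof.
move=> mF Foo; apply/integrableP; split.
  by apply: measurable_funTS; apply/measurable_EFinP; exact: measurable_dotp.
apply: le_lt_trans Foo; rewrite le_eqVlt; apply/orP; left; apply/eqP.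
by apply: eq_integral => y _; rewrite /= ger0_norm// dotp_ge0.
Qed.

(** Throughout, [V] is the limit profile and [w] an approximation of it, with
    error [d]; the integrals [P] of [|V|^2] and [Z] of [|d|^2] over a box are the
    only quantities by which [V] and [w] enter the estimates. *)
Section Bounds.
Variables (V w : R3 R -> R3 R) (N : R).
Hypothesis mV : forall i, measurable_fun setT (coord3 i \o V).
Hypothesis mw : forall i, measurable_fun setT (coord3 i \o w).
Let d := fun y => w y - V y.
Hypothesis iV : mu.-integrable (box N) (EFin \o sqnorm V).
Hypothesis iD : mu.-integrable (box N) (EFin \o sqnorm d).
Let vol := \int[mu]_(y in box N) (1 : R).
Let P := \int[mu]_(y in box N) sqnorm V y.
Let Z := \int[mu]_(y in box N) sqnorm d y.

Lemma Rintegral_sq_bound (f : R3 R -> R) (c0 c1 c2 : R) :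
  measurable_fun setT f ->
  (forall y, box N y -> `|f y| <= c0 + c1 * sqnorm V y + c2 * sqnorm d y) ->
  mu.-integrable (box N) (EFin \o f) /\
  `|\int[mu]_(y in box N) f y| <= c0 * vol + c1 * P + c2 * Z.
Proof.
move=> mf fb.
have mB := @measurable_box R N.
have i1 : mu.-integrable (box N) (EFin \o (fun _ : R3 R => c0)).
  by apply: continuous_integrable_box => x; exact: cvg_cst.
have i11 : mu.-integrable (box N) (EFin \o (fun _ : R3 R => 1)).
  by apply: continuous_integrable_box => x; exact: cvg_cst.
have i2 : mu.-integrable (box N) (EFin \o (fun y => c1 * sqnorm V y)).
  exact: (integrableZl mB c1 iV).
have i3 : mu.-integrable (box N) (EFin \o (fun y => c2 * sqnorm d y)).
  exact: (integrableZl mB c2 iD).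
have i4 : mu.-integrable (box N) (EFin \o (fun y => c0 + c1 * sqnorm V y)).
  exact: (integrableD mB i1 i2).
have i5 : mu.-integrable (box N) (EFin \o (fun y => c0 + c1 * sqnorm V y + c2 * sqnorm d y)).
  exact: (integrableD mB i4 i3).
have intf : mu.-integrable (box N) (EFin \o f).
  apply: le_integrable i5 => //.
    by apply: measurable_funTS; exact/measurable_EFinP.
  by move=> y yN /=; rewrite lee_fin (le_trans (fb _ yN))// ler_norm.
split => //.
apply: (le_trans (le_normr_Rintegral mB intf)).
have -> : c0 * vol + c1 * P + c2 * Z =
    \int[mu]_(y in box N) (c0 + c1 * sqnorm V y + c2 * sqnorm d y).
  rewrite (RintegralD mB i4 i3) (RintegralD mB i1 i2).
  rewrite (RintegralZl c1 mB iV) (RintegralZl c2 mB iD); congr (_ + _ + _).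
  rewrite -(RintegralZl c0 mB i11).
  by apply: eq_Rintegral => y _; rewrite mulr1.
apply: le_Rintegral => //.
exact: (integrable_norm intf).
Qed.

Let wE y : w y = V y + d y.
Proof. by rewrite /d addrC subrK. Qed.

Let sqnorm_sum_le y : sqnorm w y <= 2 * sqnorm V y + 2 * sqnorm d y.
Proof. by rewrite {1}/sqnorm wE dotpD_le. Qed.

Lemma linear_form_bound (g : R3 R -> R3 R) (K : R) : 0 <= K ->
  (forall i, measurable_fun setT (coord3 i \o g)) ->
  (forall i y, box N y -> `|coord3 i (g y)| <= K) ->
  `|\int[mu]_(y in box N) dotp (w y) (g y)| <= 3 * K / 2 * vol + 3 * K * P + 3 * K * Z.
Proof.
move=> K0 mg gK.
apply: (proj2 (@Rintegral_sq_bound _ (3 * K / 2) (3 * K) (3 * K) _ _)).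
  exact: measurable_dotp.
move=> y yN.
apply: (le_trans (@dotp_young (w y) (g y) K 1 ltr01 K0 (fun i => gK i y yN))).
rewrite -/(sqnorm w y) !mulr1.
have := sqnorm_sum_le y; rewrite -(ler_pM2l (_ : 0 < 3 / 2))// => h.
have {}h := ler_wpM2l K0 h.
lra.
Qed.

Lemma linear_form_close (g : R3 R -> R3 R) (K eta : R) : 0 <= K -> 0 < eta ->
  (forall i, measurable_fun setT (coord3 i \o g)) ->
  (forall i y, box N y -> `|coord3 i (g y)| <= K) ->
  `|\int[mu]_(y in box N) dotp (w y) (g y) - \int[mu]_(y in box N) dotp (V y) (g y)|
  <= 3 * K * eta / 2 * vol + 3 * K / (2 * eta) * Z.
Proof.
move=> K0 e0 mg gK.
have mwg := measurable_dotp mw mg.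
have mVg := measurable_dotp mV mg.
have iw : mu.-integrable (box N) (EFin \o (fun y => dotp (w y) (g y))).
  apply: (proj1 (@Rintegral_sq_bound _ (3 * K / 2) (3 * K) (3 * K) _ _)) => //.
  move=> y yN.
  apply: (le_trans (@dotp_young (w y) (g y) K 1 ltr01 K0 (fun i => gK i y yN))).
  rewrite -/(sqnorm w y) !mulr1.
  have := sqnorm_sum_le y; rewrite -(ler_pM2l (_ : 0 < 3 / 2))// => h.
  have {}h := ler_wpM2l K0 h.
  lra.
have iVg : mu.-integrable (box N) (EFin \o (fun y => dotp (V y) (g y))).
  apply: (proj1 (@Rintegral_sq_bound _ (3 * K / 2) (3 * K / 2) 0 _ _)) => //.
  move=> y yN.
  apply: (le_trans (@dotp_young (V y) (g y) K 1 ltr01 K0 (fun i => gK i y yN))).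
  by rewrite -/(sqnorm V y) !mulr1 mul0r addr0.
rewrite -(RintegralB (@measurable_box R N) iw iVg).
apply: (le_trans (proj2 (@Rintegral_sq_bound _ (3 * K * eta / 2) 0 (3 * K / (2 * eta)) _ _))).
- exact: measurable_funB.
- move=> y yN; rewrite mul0r addr0.
  have -> : dotp (w y) (g y) - dotp (V y) (g y) = dotp (d y) (g y).
    rewrite /dotp -sumrB; apply: eq_bigr => i _.
    by rewrite /d coord3B mulrBl.
  exact: dotp_young (fun i => gK i y yN).
- by rewrite mul0r addr0.
Qed.

Lemma quadratic_form_close (A A' : 'I_3 -> 'I_3 -> R3 R -> R) (K om eta : R) :
  0 <= K -> 0 < eta -> eta <= 1 ->
  (forall i j, measurable_fun setT (A i j)) ->
  (forall i j, measurable_fun setT (A' i j)) ->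
  (forall i j y, box N y -> `|A i j y| <= K) ->
  (forall i j y, box N y -> `|A' i j y| <= K) ->
  (forall i j y, box N y -> `|A' i j y - A i j y| <= om) ->
  `|\int[mu]_(y in box N) qform (w y) (fun i j => A' i j y) -
    \int[mu]_(y in box N) qform (V y) (fun i j => A i j y)|
  <= 9 * (K * eta + om) * P + 9 * (2 * K / eta) * Z.
Proof.
move=> K0 e0 e1 mA mA' AK A'K A'A.
have mqw := measurable_qform mw mA'.
have mqV := measurable_qform mV mA.
have iw : mu.-integrable (box N) (EFin \o (fun y => qform (w y) (fun i j => A' i j y))).
  apply: (proj1 (@Rintegral_sq_bound _ 0 (18 * K * 2) (18 * K * 2) _ _)) => //.
  move=> y yN.
  apply: (le_trans (@qform_le (w y) (fun i j => A' i j y) K K0 (fun i j => A'K i j y yN))).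
  rewrite -/(sqnorm w y) add0r.
  have K18 : 0 <= 18 * K by rewrite mulr_ge0.
  by apply: (le_trans (ler_wpM2l K18 (sqnorm_sum_le y))); rewrite mulrDr !mulrA.
have iVg : mu.-integrable (box N) (EFin \o (fun y => qform (V y) (fun i j => A i j y))).
  apply: (proj1 (@Rintegral_sq_bound _ 0 (18 * K) 0 _ _)) => //.
  move=> y yN.
  apply: (le_trans (@qform_le (V y) (fun i j => A i j y) K K0 (fun i j => AK i j y yN))).
  by rewrite -/(sqnorm V y) add0r mul0r addr0.
rewrite -(RintegralB (@measurable_box R N) iw iVg).
apply: (le_trans (proj2 (@Rintegral_sq_bound _ 0 (9 * (K * eta + om)) (9 * (2 * K / eta)) _ _))).
- exact: measurable_funB.
- move=> y yN; rewrite add0r wE.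
  apply: qform_diff_le => // i j; [exact: A'K|exact: A'A].
- by rewrite mul0r add0r.
Qed.

End Bounds.
End FormIntegrals.

(** * Dilations of functions *)

Section Dilation.
Context {R : realType}.
Implicit Types (f : R3 R -> R) (x y v : R3 R).

Lemma is_derive_from_line f x v (l : R) :
  is_derive (0 : R) 1 (fun t : R => f (t *: v + x)) l -> is_derive x v f l.
Proof.
move=> [dg <-].
have E : (fun h : R => h^-1 *: (((fun t : R => f (t *: v + x)) \o shift 0) (h *: (1 : R)) -
     f (0 *: v + x))) =
     (fun h : R => h^-1 *: ((f \o shift x) (h *: v) - f x)).
  apply/funext => h /=.
  by rewrite addr0 scale0r add0r; congr (_ *: (f (_ *: v + x) - _)); exact: mulr1.
apply: DeriveDef.
  by move: dg; rewrite /derivable /= E.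
by rewrite /derive /= E.
Qed.

(** Along the line through [x] the dilated function is a one-variable function
    composed with multiplication by [c]; the chain rule is thus needed in one
    variable only, and directional differentiability suffices. *)
Lemma is_derive_dilate f (c : R) x v : derivable f (c *: x) v ->
  is_derive x v (fun y => f (c *: y)) (c * 'D_v f (c *: x)).
Proof.
move=> df; apply: is_derive_from_line.
pose g (t : R) := f (t *: v + c *: x).
have dg : is_derive (c * 0) 1 g ('D_v f (c *: x)).
  have E0 : (c * 0) *: v + c *: x = c *: x by rewrite mulr0 scale0r add0r.
  by rewrite -[in X in is_derive _ _ _ X]E0; apply: is_derive_line; rewrite E0.
have -> : (fun t : R => f (c *: (t *: v + x))) = g \o ( *%R c).
  by apply/funext => t; rewrite /g/= scalerDr scalerA.
have dc : is_derive (0 : R) 1 ( *%R c) c.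
  rewrite -[X in is_derive _ _ _ X]mulr1.
  exact: (is_deriveZ c (is_derive_id (0 : R) 1)).
by rewrite mulrC; exact: is_derive1_comp.
Qed.

Lemma partial_dilate f (c : R) j x : C1 f ->
  partial j (fun y => f (c *: y)) x = c * partial j f (c *: x).
Proof.
move=> Cf; have [df _] := Cf j.
by apply: derive_val; exact: is_derive_dilate.
Qed.

Lemma continuous_dilate f (c : R) : continuous f -> continuous (fun y => f (c *: y)).
Proof.
move=> cf x; apply: (@continuous_comp _ _ _ (fun y : R3 R => c *: y) f); last exact: cf.
exact: scaler_continuous.
Qed.

Lemma C1_dilate f (c : R) : C1 f -> C1 (fun y => f (c *: y)).
Proof.
move=> Cf j; have [df cp] := Cf j; split=> [x|].
  by apply: ex_derive; exact: is_derive_dilate.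
have -> : partial j (fun y => f (c *: y)) = fun x => c * partial j f (c *: x).
  by apply/funext => x; exact: partial_dilate.
by move=> x; apply: cvgM; [exact: cvg_cst|exact: continuous_dilate].
Qed.

Lemma supp_dilate {U : zmodType} (f : R3 R -> U) (M N rho : R) :
  0 < rho -> M <= rho * N -> supp_box M f -> supp_box N (fun y => f (rho *: y)).
Proof.
move=> r0 MN fM y yN; apply: fM => h; apply: yN.
rewrite /box/= -(ler_pM2l r0) -[X in X * `|y|](gtr0_norm r0) -normrZ.
exact: le_trans h MN.
Qed.

(** Inside the box [2 M] this is compactness together with the joint continuity
    of [f (rho y)] in [(rho, y)].  Outside it both terms vanish as soon as
    [1 / 2 <= rho], since [rho y] is then outside the box [M]. *)
Lemma dilate_uniform f (M e : R) : continuous f -> 0 < M -> supp_box M f -> 0 < e ->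
  exists2 del : R, 0 < del <= 1 / 2 &
    forall rho, `|rho - 1| <= del -> forall y, `|f (rho *: y) - f y| <= e.
Proof.
move=> cf M0 fM e0.
have : \forall rho \near (1 : R), box (2 * M) `<=` (fun y => `|f (rho *: y) - f y| <= e).
  have /compact_near_coveringP cov := @compact_box R (2 * M).
  apply: (cov R (nbhs (1 : R)) (fun rho y => `|f (rho *: y) - f y| <= e) _) => y _.
  have ch : {for (y, (1 : R)), continuous (fun z : R3 R * R => f (z.2 *: z.1) - f z.1)}.
    apply: cvgB.
      apply: (@continuous_comp _ _ _ (fun z : R3 R * R => z.2 *: z.1) f); last exact: cf.
      by apply: cvgZ; [exact: cvg_snd|exact: cvg_fst].
    by apply: (@continuous_comp _ _ _ fst f); [exact: cvg_fst|exact: cf].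
  move/cvgrPdist_le : ch => /(_ _ e0).
  apply: filterS => z /=.
  by rewrite scale1r subrr sub0r normrN.
move=> /(proj1 (nbhs_normP _ _))[r /= r0 hr].
exists (Num.min (r / 2) (1 / 2)).
  by rewrite lt_min !divr_gt0//= ge_min lexx orbT.
move=> rho; rewrite le_min => /andP[rr r2] y.
have [yM|yM] := pselect (box (2 * M) y).
  by apply: hr => //; rewrite /ball_/= distrC (le_lt_trans rr)// ltr_pdivrMr// ltr_pMr// ltr1n.
have rho2 : 1 / 2 <= rho.
  by move: r2; rewrite ler_norml => /andP[]; lra.
have rho0 : 0 < rho by lra.
rewrite (fM y); last by move=> h; apply: yM; apply: le_box h; lra.
rewrite (@supp_dilate _ f M (2 * M) rho)//; first by rewrite subrr normr0 ltW.
by have := ler_wpM2r (ltW M0) rho2; lra.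
Qed.

End Dilation.

Section L2close.
Context {R : realType}.
Local Notation mu := (@lebesgue3 R).

Lemma measurable_coord3B (F G : R3 R -> R3 R) i :
  measurable_fun setT (coord3 i \o F) -> measurable_fun setT (coord3 i \o G) ->
  measurable_fun setT (coord3 i \o (fun y => F y - G y)).
Proof.
move=> mF mG; rewrite (_ : _ \o _ = (coord3 i \o F) \- (coord3 i \o G)).
  exact: measurable_funB.
by apply/funext => y; rewrite /= coord3B.
Qed.

Lemma measurable_rescale (al l : R) (u : R3 R -> R3 R) i : 0 < l ->
  measurable_fun setT u -> measurable_fun setT (coord3 i \o rescale al l u).
Proof.
move=> l0 mu_; rewrite (_ : _ \o _ = fun y => l `^ al * (coord3 i \o u) (l *: y)).
  apply: measurable_funM => //; have [_ ms _] := lebesgue3_scale l0.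
  exact: measurableT_comp (measurable_coord3 i mu_) ms.
by apply/funext => y; rewrite /= /rescale coord3Z.
Qed.

Lemma near_left_ex (T : R) (P : R -> Prop) :
  (\forall t \near T^'-, P t) ->
  exists2 eta : R, 0 < eta & forall t, T - eta < t < T -> P t.
Proof.
move=> /nbhs_normP[eta /= eta0 h]; exists eta => // t /andP[t1 t2].
apply: h => //; rewrite /ball_/= ger0_norm ?subr_ge0 ?ltW//; lra.
Qed.

Variables (T beta alpha R1 : R) (v : R -> R3 R -> R3 R) (V : R3 R -> R3 R).
Let lam t := (T - t) `^ beta.

(** As [t] tends to [T] the radius [R1 / lam t] of the ball in
    [rescaled_L2norm] tends to infinity, so that a given box is eventually
    contained in that ball. *)
Lemma L2_close : 0 < T -> 0 < beta -> 0 < R1 ->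
  (forall t, 0 <= t < T -> measurable_fun setT (v t)) -> measurable_fun setT V ->
  ((lam t `^ (alpha - 3 / 2))%:E * L2norm (eball R1)
     (fun x => v t x - (lam t `^ alpha)^-1 *: V ((lam t)^-1 *: x))%R)%E @[t --> T^'-] --> 0%E ->
  forall M e : R, 0 < e -> \forall t \near T^'-,
   (\int[mu]_(y in box M)
     (sqnorm (fun y => rescale alpha (lam t) (v t) y - V y) y)%:E <= e%:E)%E.
Proof.
move=> T0 b0 R10 mv mV hyp M e e0.
pose s := Num.sqrt e.
have s0 : 0 < s by rewrite sqrtr_gt0.
have hs : \forall t \near T^'-, ((lam t `^ (alpha - 3 / 2))%:E * L2norm (eball R1)
     (fun x => v t x - (lam t `^ alpha)^-1 *: V ((lam t)^-1 *: x))%R < s%:E)%E.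
  have h0 : nbhs 0%E [set x : \bar R | (x < s%:E)%E].
    by apply: open_nbhs_nbhs; split; [exact: open_ereal_lt_ereal|rewrite /= lte_fin].
  exact: (hyp _ h0).
pose M' := `|M| + 1.
have M'0 : 0 < M' by rewrite ltr_pwDr.
(* the factor 2 exceeds the ratio sqrt 3 between the Euclidean and sup norms *)
pose r := R1 / (2 * M').
have r0 : 0 < r by rewrite divr_gt0// mulr_gt0.
near=> t.
have tT : t < T by near: t; exact: nbhs_left_lt.
have t0 : 0 <= t by rewrite ltW//; near: t; exact: nbhs_left_gt.
have tr : T - t < r `^ (beta^-1).
  by near: t; apply: nbhs_left_ltBl; rewrite powR_gt0.
have Tt0 : 0 < T - t by rewrite subr_gt0.
have l0 : 0 < lam t by rewrite powR_gt0.
have lr : lam t < r.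
  have -> : r = (r `^ beta^-1) `^ beta.
    by rewrite -powRrM mulVf ?gt_eqF// powRr1// ltW.
  by rewrite /lam gt0_ltr_powR// nnegrE ?powR_ge0// ltW.
have mvt : measurable_fun setT (v t) by apply: mv; rewrite t0.
have md i : measurable_fun setT (coord3 i \o (fun y => rescale alpha (lam t) (v t) y - V y)).
  by apply: measurable_coord3B; [exact: measurable_rescale|exact: measurable_coord3].
have close : ((lam t `^ (alpha - 3 / 2))%:E * L2norm (eball R1)
     (fun x => v t x - (lam t `^ alpha)^-1 *: V ((lam t)^-1 *: x))%R < s%:E)%E.
  by near: t.
apply: (@le_trans _ _ (\int[mu]_(y in eball (R1 / lam t))
     (sqnorm (fun y => rescale alpha (lam t) (v t) y - V y) y)%:E)%E).
  apply: ge0_subset_integral.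
  - exact: measurable_box.
  - exact: measurable_eball.
  - apply: measurable_funTS; apply/measurable_EFinP.
    exact: measurable_dotp.
  - by move=> y _; rewrite lee_fin dotp_ge0.
  - move=> y; rewrite /box/eball/= => yM.
    rewrite (le_lt_trans (enorm_le_norm y))// ltr_pdivlMr//.
    apply: (@le_lt_trans _ _ (2 * M' * lam t)).
      rewrite ler_pM2r// ler_pM2l// (le_trans yM)// /M'.
      by rewrite (le_trans (ler_norm M))// lerDl.
    by rewrite mulrC -ltr_pdivlMr// mulr_gt0.
rewrite -(rescaled_L2norm alpha R1 l0 mvt mV).
move: close; set X := (_ * L2norm _ _)%E.
have X0 : (0 <= X)%E by rewrite mule_ge0// ?lee_fin ?powR_ge0// Lnorm_ge0.
case: X X0 => [x| |]//; rewrite !lee_fin lte_fin => x0 xs.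
rewrite powR_mulrn//.
have -> : e = s ^+ 2 by rewrite sqr_sqrtr// ltW.
by rewrite lerXn2r ?nnegrE// ltW.
Unshelve. all: end_near.
Qed.

End L2close.

(** * Powers and the final growth argument *)

Section Growth.
Context {R : realType}.

(** The exponents [3 - alpha] and [3 - 2 alpha] may have either sign, hence the
    absolute values. *)
Lemma powR_near1_bounds (rho x : R) : 1 / 2 <= rho <= 1 ->
  (2 `^ `|x|)^-1 <= rho `^ x <= 2 `^ `|x|.
Proof.
move=> /andP[r2 r1].
have r0 : 0 < rho by lra.
have ln2 : `|ln rho| <= ln 2.
  have h1 : ln rho <= 0 by rewrite -(@ln1 R) ler_ln// posrE.
  have h2 : - ln 2 <= ln rho by rewrite -lnV ?posrE// ler_ln ?posrE// ?invr_gt0//; lra.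
  by rewrite ler_norml h2 (le_trans h1)// ln_ge0// ler1n.
have h : `|x * ln rho| <= `|x| * ln 2 by rewrite normrM ler_wpM2l.
rewrite -powRN /powR !gt_eqF// !ler_expR.
by move: h; rewrite ler_norml -mulNr.
Qed.

(** With [l = tau `^ beta], the powers of [rho] and [rho1] are bounded above and
    below by constants, so the inequality reads
    [tau * l `^ (2 - 2 alpha) <= D * l `^ (3 - alpha)] up to a constant.  Since
    [l `^ (alpha + 1) = tau `^ gamma], this is [tau `^ (1 - gamma) <= D], which
    fails for small [tau]. *)
Lemma powR_blowup (alpha beta gamma C c tau0 : R) :
  1 < gamma -> beta * (alpha + 1) = gamma -> 0 < c -> 0 <= C -> 0 < tau0 ->
  ~ (forall tau, 0 < tau < tau0 -> exists rho rho1 : R,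
      [/\ 1 / 2 <= rho <= 1, 1 / 2 <= rho1 <= 1 &
       tau * (c * ((rho * tau `^ beta) `^ (3 - 2 * alpha) / tau `^ beta)) <=
       C * ((tau `^ beta) `^ (3 - alpha) + (rho1 * tau `^ beta) `^ (3 - alpha))]).
Proof.
move=> g1 bg c0 C0 t00 h.
pose m := 2 `^ `|3 - 2 * alpha| : R; pose m' := 2 `^ `|3 - alpha| : R.
have m0 : 0 < m by rewrite powR_gt0.
have m'0 : 0 < m' by rewrite powR_gt0.
pose D := C * (1 + m') * m / c.
have D0 : 0 <= D by rewrite /D !mulr_ge0 ?addr_ge0 ?invr_ge0// ltW.
(* at tau = s the quantity tau `^ (1 - gamma) equals D + 1 *)
pose s := ((D + 1)^-1) `^ (gamma - 1)^-1.
have D1 : 0 < D + 1 by rewrite ltr_wpDl.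
have s0 : 0 < s by rewrite powR_gt0// invr_gt0.
have g10 : 0 < gamma - 1 by rewrite subr_gt0.
pose tau := Num.min (tau0 / 2) s.
have tau_gt0 : 0 < tau by rewrite lt_min divr_gt0.
have tau_lt : tau < tau0.
  by rewrite gt_min ltr_pdivrMr// ltr_pMr// ltr1n.
have tau_s : tau <= s by rewrite ge_min lexx orbT.
have tau_le : tau `^ (gamma - 1) <= (D + 1)^-1.
  have -> : (D + 1)^-1 = s `^ (gamma - 1).
    by rewrite /s -powRrM mulVf ?gt_eqF// powRr1// invr_ge0 ltW.
  by apply: (ge0_ler_powR (ltW g10)) => //; rewrite nnegrE ltW.
have [|rho [rho1 [hr hr1]]] := h tau; first by rewrite tau_gt0.
set l := tau `^ beta => ineq.
have l0 : 0 < l by rewrite powR_gt0.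
have [r0 r10] : 0 < rho /\ 0 < rho1.
  by move: hr hr1 => /andP[? _] /andP[? _]; split; lra.
move: ineq; rewrite (powRM _ (ltW r0) (ltW l0)) (powRM _ (ltW r10) (ltW l0)) => ineq.
have /andP[b1 _] := powR_near1_bounds (3 - 2 * alpha) hr.
have /andP[_ b2] := powR_near1_bounds (3 - alpha) hr1.
have L1 : l `^ (3 - 2 * alpha) / l = tau `^ (- gamma) * l `^ (3 - alpha).
  rewrite -[X in _ / X](powRr1 (ltW l0)) -powRN -powRD; last by rewrite (gt_eqF l0); case: (_ == _).
  have -> : tau `^ (- gamma) = l `^ (- (alpha + 1)).
    by rewrite /l -powRrM mulrN bg.
  rewrite -powRD; last by rewrite (gt_eqF l0); case: (_ == _).
  by congr powR; ring.
have L0 : 0 < l `^ (3 - alpha) by rewrite powR_gt0.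
have e1 : tau * (c * (m^-1 * (tau `^ (- gamma) * l `^ (3 - alpha)))) <= C * (1 + m') * l `^ (3 - alpha).
  apply: le_trans (le_trans _ ineq) _.
    rewrite -L1 ler_pM2l// ler_pM2l// mulrA ler_pM2r ?invr_gt0// ler_pM2r// powR_gt0//.
  rewrite -mulrA ler_wpM2l// mulrDl mul1r lerD2l ler_pM2r//.
have tg : tau * tau `^ (- gamma) = (tau `^ (gamma - 1))^-1.
  rewrite -powRN -{1}(powRr1 (ltW tau_gt0)) -powRD; last by rewrite (gt_eqF tau_gt0); case: (_ == _).
  by congr powR; ring.
have e2 : tau * tau `^ (- gamma) <= D.
  rewrite /D ler_pdivlMr// -(ler_pM2r L0).
  have := ler_wpM2r (ltW m0) e1.
  have -> : tau * (c * (m^-1 * (tau `^ (- gamma) * l `^ (3 - alpha)))) * m = tau * tau `^ (- gamma) * c * l `^ (3 - alpha).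
    by field; rewrite gt_eqF.
  by rewrite [X in _ <= X -> _]mulrAC.
have : D + 1 <= D.
  apply: le_trans e2; rewrite tg.
  by rewrite -[leLHS]invrK lef_pV2 ?posrE ?powR_gt0 ?invr_gt0.
by rewrite gerDl leNgt ltr01.
Qed.

End Growth.

(** * Pairing and flux in self-similar variables *)

Section RescaledFields.
Context {R : realType}.
Local Notation mu := (@lebesgue3 R).
Implicit Types (u phi : R3 R -> R3 R).

Lemma C1_field_continuous u : C1_field u -> forall i, continuous (coord3 i \o u).
Proof. by move=> Cu i; exact: C1_continuous. Qed.

Lemma measurable_C1_field u : C1_field u -> measurable_fun setT u.
Proof.
move=> Cu; have m i : measurable_fun setT (coord3 i \o u).
  by apply: continuous3_measurable; exact: C1_field_continuous.
rewrite (_ : u = fun x => (((coord3 0 \o u) x, (coord3 1 \o u) x), (coord3 2 \o u) x)); last first.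
  by apply/funext => x; rewrite /coord3 /=; case: (u x) => -[].
by apply: measurable_fun_pair => //; exact: measurable_fun_pair.
Qed.

Lemma coord3_rescale (al l : R) u i :
  coord3 i \o rescale al l u = fun y => l `^ al * (coord3 i \o u) (l *: y).
Proof. by apply/funext => y; rewrite /= /rescale coord3Z. Qed.

Lemma C1_cst (c : R) : C1 (fun _ : R3 R => c).
Proof.
move=> j; split=> [x|]; first exact: derivable_cst.
have -> : partial j (fun _ : R3 R => c) = fun _ => 0.
  by apply/funext => x; exact: derive_cst.
by move=> x; exact: cvg_cst.
Qed.

Lemma C1_rescale (al l : R) u : C1_field u -> C1_field (rescale al l u).
Proof.
move=> Cu i; rewrite coord3_rescale; apply: C1M; first exact: C1_cst.
exact: C1_dilate.
Qed.

Lemma divergence_rescale (al l : R) u y : C1_field u ->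
  divergence (rescale al l u) y = l `^ al * l * divergence u (l *: y).
Proof.
move=> Cu; rewrite /divergence mulr_sumr; apply: eq_bigr => i _.
rewrite coord3_rescale (partialM _ _ (C1_cst _) (C1_dilate l (Cu i))).
rewrite (partial_dilate _ _ _ (Cu i)).
have -> : partial i (fun _ : R3 R => l `^ al) y = 0 by exact: derive_cst.
by rewrite mul0r add0r mulrA.
Qed.

Lemma C1_field_dilate (c : R) phi : C1_field phi -> C1_field (fun x => phi (c *: x)).
Proof. by move=> Cphi i; exact: (C1_dilate c (Cphi i)). Qed.

Lemma divergence_dilate (c : R) phi x : C1_field phi ->
  divergence (fun x => phi (c *: x)) x = c * divergence phi (c *: x).
Proof.
move=> Cphi; rewrite /divergence mulr_sumr; apply: eq_bigr => i _.
exact: (partial_dilate c i x (Cphi i)).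
Qed.

Variables (al l l0 : R) (u phi : R3 R -> R3 R) (M N : R).
Hypotheses (l_gt0 : 0 < l) (l0_gt0 : 0 < l0).
Hypothesis Cu : C1_field u.
Hypothesis Cphi : C1_field phi.
Hypothesis phiM : supp_box M phi.
Let rho := l / l0.
(* the support of the dilated test field phi (rho y) lies in the box N *)
Hypothesis MN : M <= rho * N.
Let w := rescale al l u.
Let Phi x := phi (l0^-1 *: x).

Let rho_gt0 : 0 < rho. Proof. by rewrite divr_gt0. Qed.
Let CPhi : C1_field Phi. Proof. exact: C1_field_dilate. Qed.

Lemma coord3_unscale i y : coord3 i (u (l *: y)) = l `^ (- al) * coord3 i (w y).
Proof. by rewrite /w /rescale coord3Z mulrA powRN mulVf ?mul1r// gt_eqF// powR_gt0. Qed.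

(** [Phi] lives at the scale [l0] and [u] is rescaled at the scale [l], so the
    test field becomes [phi] dilated by the ratio [rho = l / l0]; the volume
    element contributes [l ^+ 3]. *)
Lemma pairing_rescale :
  \int[mu]_x dotp (u x) (Phi x) =
  l `^ (3 - al) * \int[mu]_(y in box N) dotp (w y) (phi (rho *: y)).
Proof.
have cg := continuous_dotp (@C1_field_continuous _ Cu) (@C1_field_continuous _ CPhi).
have E y : dotp (u (l *: y)) (Phi (l *: y)) = l `^ (- al) * dotp (w y) (phi (rho *: y)).
  rewrite /dotp mulr_sumr; apply: eq_bigr => i _.
  by rewrite coord3_unscale /Phi scalerA (mulrC l0^-1) mulrA.
have sN : supp_box N (fun y => dotp (w y) (phi (rho *: y))).
  move=> y yN; rewrite (supp_dilate rho_gt0 MN phiM yN) /dotp big1// => i _.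
  by rewrite coord3_0 mulr0.
have cw : continuous (fun y => dotp (w y) (phi (rho *: y))).
  apply: continuous_dotp; first exact: @C1_field_continuous _ (C1_rescale al l Cu).
  exact: @C1_field_continuous _ (C1_field_dilate rho Cphi).
have iw := continuous_supp_integrable cw sN.
rewrite (Rintegral_scale (lebesgue3_scale l_gt0)); last 2 first.
- exact: continuous3_measurable.
- rewrite (_ : _ \o _ = fun y => (l `^ (- al))%:E * (EFin \o (fun y => dotp (w y) (phi (rho *: y)))) y)%E.
    exact: integrableZl.
  by apply/funext => y /=; rewrite E.
under eq_Rintegral do rewrite E.
rewrite RintegralZl// (Rintegral_supp sN) mulrA; congr (_ * _).
rewrite -powR_mulrn ?ltW// -powRD//; by rewrite (gt_eqF l_gt0); case: (_ == _).
Qed.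

(** As in [pairing_rescale], with two factors of [u] and one derivative of
    [Phi], which yields [l0^-1]. *)
Lemma flux_rescale :
  \int[mu]_x dotp (u x) (advect u Phi x) =
  l `^ (3 - 2 * al) / l0 *
  \int[mu]_(y in box N) qform (w y) (fun i j => partial j (coord3 i \o phi) (rho *: y)).
Proof.
pose q y := qform (w y) (fun i j => partial j (coord3 i \o phi) (rho *: y)).
have E y : dotp (u (l *: y)) (advect u Phi (l *: y)) = (l `^ (- (2 * al)) / l0) * q y.
  rewrite /q /qform /dotp mulr_sumr; apply: eq_bigr => i _.
  rewrite advectE coord3_unscale !mulr_sumr; apply: eq_bigr => j _.
  rewrite coord3_unscale (partial_dilate l0^-1 j (l *: y) (Cphi i)) scalerA (mulrC l0^-1 l) -/rho.
  rewrite (_ : l `^ (- (2 * al)) = l `^ (- al) * l `^ (- al)); first by ring.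
  rewrite -powRD; last by rewrite (gt_eqF l_gt0); case: (_ == _).
  by congr powR; ring.
have sN : supp_box N q.
  move=> y yN; rewrite /q /qform big1// => i _; rewrite big1 ?mulr0// => j _.
  rewrite (supp_dilate rho_gt0 MN _ yN) ?mulr0//.
  exact: partial_supp (supp_coord3 i phiM).
have cq : continuous q.
  have -> : q = fun y => dotp (w y) (vec3 (fun i => dotp (w y)
      (vec3 (fun j => partial j (coord3 i \o phi) (rho *: y))))).
    apply/funext => y; rewrite /q /qform /dotp; apply: eq_bigr => i _.
    by rewrite coord3_vec3; congr (_ * _); apply: eq_bigr => j _; rewrite coord3_vec3.
  have cw := @C1_field_continuous _ (C1_rescale al l Cu).
  apply: continuous_dotp => // i; rewrite (_ : _ \o _ = fun y => dotp (w y)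
      (vec3 (fun j => partial j (coord3 i \o phi) (rho *: y)))); last first.
    by apply/funext => y; rewrite /= coord3_vec3.
  apply: continuous_dotp => // j; rewrite (_ : _ \o _ = fun y =>
      partial j (coord3 i \o phi) (rho *: y)); last first.
    by apply/funext => y; rewrite /= coord3_vec3.
  by apply: continuous_dilate; have [] := Cphi i j.
have cg : continuous (fun x => dotp (u x) (advect u Phi x)).
  apply: continuous_dotp => i; first exact: C1_field_continuous.
  exact: continuous_advect (@C1_field_continuous _ Cu) CPhi.
have iq := continuous_supp_integrable cq sN.
rewrite (Rintegral_scale (lebesgue3_scale l_gt0)); last 2 first.
- exact: continuous3_measurable.
- rewrite (_ : _ \o _ = fun y => (l `^ (- (2 * al)) / l0)%:E * (EFin \o q) y)%E.
    exact: integrableZl.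
  by apply/funext => y /=; rewrite E.
under eq_Rintegral do rewrite E.
rewrite RintegralZl// (Rintegral_supp sN) mulrA mulrA; congr (_ / _ * _).
rewrite -powR_mulrn ?ltW// -powRD//; by rewrite (gt_eqF l_gt0); case: (_ == _).
Qed.

End RescaledFields.

(** * Passage to the self-similar profile *)

Lemma half_le_of_close (R : realType) (x y z : R) :
  z <= x / 2 -> x <= y + z -> x / 2 <= y.
Proof. by lra. Qed.

Lemma sub_itv (R : realType) (T s x y : R) :
  T - y < s -> s < T - x -> x <= T - s <= y.
Proof. by move=> h1 h2; apply/andP; split; lra. Qed.

Lemma half_dilate_le (R : realType) (M rho : R) : 0 < M -> 1 / 2 <= rho ->
  M <= rho * (2 * M).
Proof. by move=> M0 r2; have := ler_wpM2r (ltW M0) r2; lra. Qed.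

Lemma ge_half_gt0 (R : realType) (x : R) : 1 / 2 <= x -> 0 < x.
Proof. by lra. Qed.

Lemma half_le_onem (R : realType) (x : R) : x <= 1 / 2 -> 1 / 2 <= 1 - x.
Proof. by lra. Qed.

Lemma dist1_le (R : realType) (d x : R) : 0 < d -> 1 - d <= x -> x <= 1 ->
  `|x - 1| <= d.
Proof. by move=> d0 h1 h2; rewrite ler_norml; apply/andP; split; lra. Qed.

Section WeakLimit.
Context {R : realType}.
Local Notation mu := (@lebesgue3 R).
Variables (T alpha beta R1 : R) (v : R -> R3 R -> R3 R) (V : R3 R -> R3 R).
Hypotheses (T0 : 0 < T) (b0 : 0 < beta) (R10 : 0 < R1).
Hypothesis ev : euler_classical T v.
Hypothesis LV : L2loc V.
Let lam t := (T - t) `^ beta.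
Hypothesis hyp : ((lam t `^ (alpha - 3 / 2))%:E * L2norm (eball R1)
     (fun x => v t x - (lam t `^ alpha)^-1 *: V ((lam t)^-1 *: x))%R)%E @[t --> T^'-] --> 0%E.
Let w t := rescale alpha (lam t) (v t).
Let vol N := \int[mu]_(y in box N) (1 : R).
Let P N := \int[mu]_(y in box N) sqnorm V y.
Let Z N t := \int[mu]_(y in box N) sqnorm (fun y => w t y - V y) y.

Let mV i : measurable_fun setT (coord3 i \o V).
Proof. by apply: measurable_coord3; case: LV. Qed.

Let Cv t : 0 <= t < T -> C1_field (v t).
Proof. by case: ev => _ + _ _ _; apply. Qed.

Let lam_gt0 t : t < T -> 0 < lam t.
Proof. by move=> tT; rewrite powR_gt0// subr_gt0. Qed.

Let mw t i : 0 <= t < T -> measurable_fun setT (coord3 i \o w t).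
Proof.
move=> h; apply: measurable_rescale; first by apply: lam_gt0; case/andP: h.
by apply: measurable_C1_field; exact: Cv.
Qed.

Let iV N : mu.-integrable (box N) (EFin \o sqnorm V).
Proof.
apply: sqnorm_integrable => //; rewrite -L2norm_sqr; apply: poweR_lty.
by case: LV => _; apply; exact: compact_box.
Qed.

(** The form in which the convergence hypothesis is used: [t] ranges over a
    true interval and [Z N t], being finite, is a real number. *)
Lemma near_blowup_data (N z : R) : 0 < z ->
  exists2 h : R, 0 < h & forall t, T - h < t < T ->
    [/\ 0 < t < T, mu.-integrable (box N) (EFin \o sqnorm (fun y => w t y - V y)) & Z N t <= z].
Proof.
move=> z0.
have mvt t : 0 <= t < T -> measurable_fun setT (v t).
  by move=> h; apply: measurable_C1_field; exact: Cv.
have [h h0 hh] := near_left_ex (L2_close T0 b0 R10 mvt (proj1 LV) hyp N z0).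
exists (Num.min h T); first by rewrite lt_min h0.
move=> t /andP[t1 tT].
have t0 : 0 < t.
  by apply: le_lt_trans t1; rewrite subr_ge0 ge_min lexx orbT.
have th : T - h < t.
  by apply: le_lt_trans t1; rewrite lerD2l lerN2 ge_min lexx.
have hz := hh t; rewrite th tT in hz; have {}hz := hz isT.
have t0T : 0 <= t < T by rewrite ltW.
have md i : measurable_fun setT (coord3 i \o (fun y => w t y - V y)).
  by apply: measurable_coord3B => //; exact: mw.
have iD : mu.-integrable (box N) (EFin \o sqnorm (fun y => w t y - V y)).
  by apply: sqnorm_integrable => //; apply: (le_lt_trans hz); exact: ltry.
split => //; first by rewrite t0.
rewrite -lee_fin /Z /Rintegral fineK//.
exact: (integrable_fin_num (@measurable_box R N) iD).
Qed.

Let vol_ge0 N : 0 <= vol N.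
Proof. exact: Rintegral_ge0. Qed.

Let P_ge0 N : 0 <= P N.
Proof. by apply: Rintegral_ge0 => y _; exact: dotp_ge0. Qed.

Let Z_ge0 N t : 0 <= Z N t.
Proof. by apply: Rintegral_ge0 => y _; exact: dotp_ge0. Qed.

(** [w t] is solenoidal, so its pairing with [grad psi] vanishes, and
    [linear_form_close] bounds the pairing of [V] by an arbitrarily small
    number. *)
Lemma weak_mass (psi : R3 R -> R) : C1_0 psi ->
  \int[mu]_y dotp (V y) (grad psi y) = 0.
Proof.
move=> [Cpsi /compact_supp_box[M [M0 psiM]]].
have cgrad i : continuous (coord3 i \o grad psi).
  rewrite (_ : _ \o _ = partial i psi); first by have [] := Cpsi i.
  by apply/funext => x; rewrite /= /grad coord3_vec3.
have gs (u : R3 R -> R3 R) : supp_box M (fun y => dotp (u y) (grad psi y)).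
  move=> y yM; rewrite /dotp big1// => i _.
  by rewrite /grad coord3_vec3 (partial_supp _ psiM yM) mulr0.
rewrite (Rintegral_supp (gs V)).
have [K K0 hK] := field_bounded_box M cgrad.
have gK i y : box M y -> `|coord3 i (grad psi y)| <= K.
  by move=> /hK; apply: le_trans; exact: coord3_le_norm.
set S := (X in X = 0).
apply/eqP; rewrite -normr_le0; apply/ler_addgt0Pl => e e0; rewrite addr0.
(* eta makes the volume term at most e / 2, then z the error term; adding 1
   keeps the denominator positive *)
pose eta := e / (3 * K * (vol M + 1)).
have v1 : 0 < vol M + 1 by rewrite ltr_wpDl.
have eta0 : 0 < eta by rewrite divr_gt0// !mulr_gt0.
pose z := e * eta / (3 * K).
have z0 : 0 < z by rewrite divr_gt0// mulr_gt0.
have [h h0 hh] := near_blowup_data M z0.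
have tth : T - h < T - h / 2 < T by apply/andP; split; lra.
have [t0T iD Zz] := hh _ tth; move: (T - h / 2) t0T iD Zz {tth} => t t0T iD Zz.
have t0T' : 0 <= t < T by case/andP: t0T => /ltW -> ->.
have mwt i : measurable_fun setT (coord3 i \o w t) by exact: mw.
have mg i : measurable_fun setT (coord3 i \o grad psi) by exact: continuous3_measurable.
have := linear_form_close mV mwt (iV M) iD (ltW K0) eta0 mg gK.
have -> : \int[mu]_(y in box M) dotp (w t y) (grad psi y) = 0.
  rewrite -(Rintegral_supp (gs (w t))).
  apply: (@integral_mass _ _ _ M) => //; first exact/C1_rescale/Cv.
  move=> x; rewrite divergence_rescale; last exact: Cv.
  by case: ev => _ _ _ _ [dv _]; rewrite dv// mulr0.
rewrite sub0r normrN => hS; apply: (le_trans hS).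
rewrite -/(vol M) -/(Z M t).
have q1 : 3 * K * eta / 2 * vol M <= e / 2.
  rewrite (_ : 3 * K * eta / 2 * vol M = (e / 2) * (vol M / (vol M + 1))); last first.
    by rewrite /eta; field; rewrite !gt_eqF.
  have e20 : 0 <= e / 2 by rewrite divr_ge0// ltW.
  by rewrite ler_piMr// ler_pdivrMr// mul1r lerDl.
have q2 : 3 * K / (2 * eta) * Z M t <= e / 2.
  apply: (@le_trans _ _ (3 * K / (2 * eta) * z)).
    by rewrite ler_wpM2l// ltW// divr_gt0// mulr_gt0.
  rewrite (_ : 3 * K / (2 * eta) * z = e / 2)//.
  by rewrite /z; field; rewrite !gt_eqF.
lra.
Qed.

Lemma supp_box_bounded (f : R3 R -> R) M : continuous f -> supp_box M f ->
  exists2 K, 0 < K & forall y, `|f y| <= K.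
Proof.
move=> cf fM; have [K K0 hK] := continuous_bounded_box M cf; exists K => // y.
have [/hK//|yM] := pselect (box M y).
by rewrite fM// normr0 ltW.
Qed.

Section Momentum.
Variables (phi : R3 R -> R3 R) (M : R).
Hypotheses (Cphi : C1_field phi) (M0 : 0 < M) (phiM : supp_box M phi).
(* the support of phi (rho y) lies in the box 2 M for every rho >= 1 / 2 *)
Let N := 2 * M.
Let A (i j : 'I_3) : R3 R -> R := partial j (coord3 i \o phi).
Let flux := \int[mu]_y dotp (V y) (advect V phi y).

Let cA i j : continuous (A i j). Proof. by have [] := Cphi i j. Qed.

Let AM i j : supp_box M (A i j).
Proof. by apply: partial_supp; exact: supp_coord3. Qed.

Let J (t rho : R) :=
  \int[mu]_(y in box N) qform (w t y) (fun i j => A i j (rho *: y)).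

Let H (t rho : R) := \int[mu]_(y in box N) dotp (w t y) (phi (rho *: y)).

Lemma fluxE : flux = \int[mu]_(y in box N) qform (V y) (fun i j => A i j y).
Proof.
rewrite /flux (@Rintegral_supp _ _ N); last first.
  apply: (supp_box_le _ (supp_advect _ phiM)).
  by rewrite /N; have := M0; lra.
apply: eq_Rintegral => y _; rewrite /dotp /qform; apply: eq_bigr => i _.
by rewrite advectE.
Qed.

(** Both sources of error, the convergence of [w t] to [V] and the dilation of
    the gradient of [phi], are independent of each other; thus [rho] need not be
    related to [t] here, and [del] does not depend on how close [t] is to [T]. *)
Lemma flux_limit (e : R) : 0 < e ->
  exists h del : R, [/\ 0 < h, 0 < del <= 1 / 2 &
    forall t rho, T - h < t < T -> 1 - del <= rho <= 1 -> `|J t rho - flux| <= e].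
Proof.
move=> e0.
have [K K0 AK] : exists2 K, 0 < K & forall i j y, `|A i j y| <= K.
  apply: common_upper3 => [i K K' KK' h j y|i]; first exact: le_trans (h j y) KK'.
  apply: (@common_upper3 _ (fun j K => forall y, `|A i j y| <= K)) => [j K K' KK' h y|j].
    exact: le_trans (h y) KK'.
  exact: supp_box_bounded (@cA i j) (@AM i j).
have P1 : 0 < P N + 1 by rewrite ltr_wpDl.
(* with these choices the terms in om, eta and z of quadratic_form_close are at
   most e / 4, e / 4 and e / 2; the summand e in eta ensures eta <= 1 *)
pose om := e / (36 * (P N + 1)).
have om0 : 0 < om by rewrite divr_gt0// mulr_gt0.
pose eta := e / (36 * K * (P N + 1) + e).
have den0 : 0 < 36 * K * (P N + 1) by rewrite !mulr_gt0.
have eta0 : 0 < eta by rewrite divr_gt0// addr_gt0.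
have eta1 : eta <= 1.
  by rewrite /eta ler_pdivrMr ?addr_gt0// mul1r lerDr ltW.
pose z := e * eta / (36 * K).
have z0 : 0 < z by rewrite divr_gt0// mulr_gt0.
have [del /andP[del0 del2] hdel] : exists2 del : R, 0 < del <= 1 / 2 &
    forall i j rho, `|rho - 1| <= del -> forall y, `|A i j (rho *: y) - A i j y| <= om.
  apply: common_lower3 => [i K' K'' KK h j rho hr|i]; first exact: h (le_trans hr KK).
  apply: (@common_lower3 _ (1 / 2) (fun j del => forall rho, `|rho - 1| <= del ->
     forall y, `|A i j (rho *: y) - A i j y| <= om)) => [j K' K'' KK h rho hr|j].
    exact: h (le_trans hr KK).
  exact: (dilate_uniform (@cA i j) M0 (@AM i j) om0).
have [h h0 hh] := near_blowup_data N z0.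
exists h, del; split => //; first by rewrite del0.
move=> t rho /hh[t0T iD Zz] /andP[r1 r2].
have t0T' : 0 <= t < T by case/andP: t0T => /ltW -> ->.
have mwt i : measurable_fun setT (coord3 i \o w t) by exact: mw.
have mA i j : measurable_fun setT (A i j) by exact: continuous3_measurable.
have mA' i j : measurable_fun setT (fun y : R3 R => A i j (rho *: y)).
  by apply: continuous3_measurable; exact: continuous_dilate.
have rd : `|rho - 1| <= del.
  exact: dist1_le.
rewrite fluxE /J.
apply: (le_trans (@quadratic_form_close _ V (w t) N mV mwt (iV N) iD A
  (fun i j (y : R3 R) => A i j (rho *: y)) K om eta (ltW K0) eta0 eta1 mA mA'
  (fun i j y _ => AK i j y) (fun i j y _ => AK i j (rho *: y))
  (fun i j y _ => hdel i j rho rd y))).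
rewrite -/(P N) -/(Z N t).
have PP : P N / (P N + 1) <= 1 by rewrite ler_pdivrMr// mul1r lerDl.
have q1 : 9 * (K * eta) * P N <= e / 4.
  have h1 : eta * (36 * K * (P N + 1)) <= e.
    rewrite /eta mulrAC ler_pdivrMr ?addr_gt0// ler_pM2l// lerDl ltW//.
  have h2 : eta * (36 * K * P N) <= eta * (36 * K * (P N + 1)).
    by rewrite ler_pM2l// ler_pM2l ?mulr_gt0// lerDl.
  lra.
have q2 : 9 * om * P N <= e / 4.
  have -> : 9 * om * P N = e / 4 * (P N / (P N + 1)).
    by rewrite /om; field; rewrite gt_eqF.
  by rewrite ger_pMr ?divr_gt0.
have q3 : 9 * (2 * K / eta) * Z N t <= e / 2.
  apply: (@le_trans _ _ (9 * (2 * K / eta) * z)).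
    by rewrite ler_wpM2l// ltW// mulr_gt0// divr_gt0// mulr_gt0.
  rewrite (_ : 9 * (2 * K / eta) * z = e / 2)//.
  by rewrite /z; field; rewrite !gt_eqF.
lra.
Qed.

Lemma pairing_bounded :
  exists h C : R, [/\ 0 < h, 0 <= C &
    forall t rho, T - h < t < T -> `|H t rho| <= C].
Proof.
have [K K0 hK] := field_bounded_box M (fun i => @C1_continuous _ _ (Cphi i)).
have phiK i y : `|coord3 i (phi y)| <= K.
  have [/hK h|yM] := pselect (box M y); first exact: le_trans (coord3_le_norm _ _) h.
  by rewrite phiM// coord3_0 normr0 ltW.
have [h h0 hh] := near_blowup_data N ltr01.
exists h, (3 * K / 2 * vol N + 3 * K * P N + 3 * K * 1); split => //.
  by rewrite !addr_ge0// ?mulr_ge0// ?divr_ge0// ltW.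
move=> t rho /hh[t0T iD Z1].
have t0T' : 0 <= t < T by case/andP: t0T => /ltW -> ->.
have mwt i : measurable_fun setT (coord3 i \o w t) by exact: mw.
have mg i : measurable_fun setT (coord3 i \o (fun y : R3 R => phi (rho *: y))).
  apply: continuous3_measurable.
  exact: (@continuous_dilate _ (coord3 i \o phi) rho (C1_continuous (Cphi i))).
apply: (le_trans (@linear_form_bound _ V (w t) N mwt (iV N) iD
  (fun y : R3 R => phi (rho *: y)) K (ltW K0) mg (fun i y _ => phiK i (rho *: y)))).
rewrite -/(vol N) -/(P N) -/(Z N t) lerD2l ler_pM2l// mulr_gt0//.
Qed.

Variable gamma : R.
Hypotheses (gamma1 : 1 < gamma) (beta_gamma : beta * (alpha + 1) = gamma).
Hypothesis dphi : forall x, divergence phi x = 0.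

(** If the flux were nonzero, the momentum of [v] against the frozen field would
    move, between [T - tau] and [T - kap * tau], by an amount of order
    [tau * l0 `^ (2 - 2 alpha)], more than the bound [l0 `^ (3 - alpha)] on its
    size allows when [tau] is small. *)
Lemma weak_momentum : flux = 0.
Proof.
apply/eqP/negP => /negP L0.
have L0' : 0 < `|flux| by rewrite normr_gt0.
have e0 : 0 < `|flux| / 2 by rewrite divr_gt0.
have [h [del [h0 /andP[del0 del2] hJ]]] := flux_limit e0.
have [h' [C [h'0 C0 hH]]] := pairing_bounded.
(* between T - tau and T - kap * tau the scale decreases exactly from l0 to
   (1 - del) * l0 *)
pose kap := (1 - del) `^ beta^-1.
have half1 : 1 / 2 <= 1 - del by exact: half_le_onem.
have d10 : 0 < 1 - del by exact: ge_half_gt0 half1.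
have kap0 : 0 < kap by rewrite powR_gt0.
have kapb : kap `^ beta = 1 - del by rewrite -powRrM mulVf ?gt_eqF// powRr1// ltW.
have kap1 : kap < 1.
  rewrite ltNge; apply/negP => k1.
  have := ge0_ler_powR (ltW b0) ler01 (ltW kap0) k1.
  by rewrite powR1 kapb leNgt gtrBl del0.
apply: (@powR_blowup R alpha beta gamma C ((1 - kap) * (`|flux| / 2))
   (Num.min T (Num.min h h')) gamma1 beta_gamma _ C0 _).
- by rewrite mulr_gt0// subr_gt0.
- by rewrite !lt_min T0 h0.
move=> tau /andP[tau0]; rewrite !lt_min => /and3P[tauT tauh tauh'].
pose l0 := tau `^ beta.
have l00 : 0 < l0 by rewrite powR_gt0.
pose Phi x := phi (l0^-1 *: x).
pose G s := \int[mu]_x dotp (v s x) (Phi x).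
pose G' s := \int[mu]_x dotp (v s x) (advect (v s) Phi x).
have CPhi : C1_field Phi by exact: C1_field_dilate.
have dPhi x : divergence Phi x = 0 by rewrite divergence_dilate// dphi mulr0.
have PhiM : supp_box (l0 * M) Phi.
  by apply: supp_dilate phiM; rewrite ?invr_gt0// mulrA mulVf ?gt_eqF// mul1r.
have lM0 : 0 < l0 * M by rewrite mulr_gt0.
have dG s : 0 < s < T -> is_derive s 1 G (G' s).
  by move=> s0T; exact: (is_derive_pairing ev CPhi lM0 PhiM dPhi).
have scaleE s : kap * tau <= T - s <= tau -> exists rho,
    [/\ lam s = rho * l0, 1 - del <= rho & rho <= 1].
  move=> /andP[s1 s2]; exists (((T - s) / tau) `^ beta).
  have q0 : 0 <= (T - s) / tau.
    by rewrite divr_ge0 ?ltW// (lt_le_trans _ s1)// mulr_gt0.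
  split.
  - by rewrite -powRM ?(ltW tau0)// divfK// gt_eqF.
  - rewrite -kapb; apply: (ge0_ler_powR (ltW b0)) => //; first by rewrite nnegrE ltW.
    by rewrite ler_pdivlMr.
  - have -> : 1 = 1 `^ beta :> R by rewrite powR1.
    apply: (ge0_ler_powR (ltW b0)); rewrite ?nnegrE//.
    by rewrite ler_pdivrMr// mul1r.
have GE s rho : T - tau <= s < T -> lam s = rho * l0 -> 1 / 2 <= rho ->
   `|G s| <= C * (rho * l0) `^ (3 - alpha).
  move=> /andP[s1 s2] lE r2.
  have s0T : 0 <= s < T by rewrite s2 andbT (le_trans _ s1)// subr_ge0 ltW.
  have rE : lam s / l0 = rho by rewrite lE mulfK// gt_eqF.
  have MN : M <= lam s / l0 * N.
    by rewrite rE; exact: half_dilate_le.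
  rewrite /G (pairing_rescale alpha (lam_gt0 s2) l00 (Cv s0T) Cphi phiM MN).
  have c0 : 0 <= lam s `^ (3 - alpha) by rewrite powR_ge0.
  rewrite -lE rE normrM (ger0_norm c0) mulrC; apply: (ler_wpM2r c0).
  by apply: (hH s rho); rewrite s2 andbT (lt_le_trans _ s1)// ltrD2l ltrN2.
have G'E s rho : T - tau < s < T -> lam s = rho * l0 -> 1 - del <= rho <= 1 ->
   (rho * l0) `^ (3 - 2 * alpha) / l0 * (`|flux| / 2) <= `|G' s|.
  move=> /andP[s1 s2] lE /andP[r1 r2].
  have s0T : 0 <= s < T by rewrite s2 andbT (le_trans _ (ltW s1))// subr_ge0 ltW.
  have rE : lam s / l0 = rho by rewrite lE mulfK// gt_eqF.
  have r2' : 1 / 2 <= rho by exact: le_trans r1.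
  have MN : M <= lam s / l0 * N.
    by rewrite rE; exact: half_dilate_le.
  rewrite /G' (flux_rescale alpha (lam_gt0 s2) l00 (Cv s0T) Cphi phiM MN).
  have c0 : 0 <= lam s `^ (3 - 2 * alpha) / l0 by rewrite divr_ge0 ?powR_ge0// ltW.
  rewrite -lE normrM (ger0_norm c0) ler_wpM2l//.
  have sh : T - h < s < T by rewrite s2 andbT (lt_trans _ s1)// ltrD2l ltrN2.
  have rd : 1 - del <= rho <= 1 by rewrite r1.
  have close := hJ s rho sh rd.
  have := ler_normB (J s rho) (J s rho - flux); rewrite subKr => tri.
  by rewrite rE; exact: half_le_of_close close tri.
have t01 : T - tau < T - kap * tau.
  by rewrite ltrD2l ltrN2 gtr_pMl.
have kt0 : 0 < kap * tau by rewrite mulr_gt0.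
have I0T s : T - tau <= s -> s <= T - kap * tau -> 0 < s < T.
  move=> h1 h2; rewrite (lt_le_trans _ h1) ?subr_gt0//=.
  by rewrite (le_lt_trans h2)// gtrBl.
have dGi s : s \in `](T - tau), (T - kap * tau)[ -> is_derive s 1 G (G' s).
  by rewrite in_itv/= => /andP[/ltW h1 /ltW h2]; apply: dG; exact: I0T.
have cG : {within `[T - tau, T - kap * tau], continuous G}.
  apply: derivable_within_continuous => s; rewrite in_itv/= => /andP[h1 h2].
  by apply: ex_derive; apply: dG; exact: I0T.
(* the time s at which G' is evaluated is uncontrolled, hence the need for a
   lower bound on G' that is uniform on the interval *)
have [s] := MVT t01 dGi cG; rewrite in_itv/= => /andP[s1 s2] mvt.
have [rho [lE r1 r2]] : exists rho, [/\ lam s = rho * l0, 1 - del <= rho & rho <= 1].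
  exact: scaleE (sub_itv s1 s2).
have [rho1 [lE1 r11 r12]] : exists rho, [/\ lam (T - kap * tau) = rho * l0, 1 - del <= rho & rho <= 1].
  apply: scaleE; rewrite opprB addrC subrK lexx/= ger_pMl// ltW//.
exists rho, rho1; split.
- by rewrite (le_trans half1 r1).
- by rewrite (le_trans half1 r11).
rewrite -/l0.
have B1 : `|G (T - kap * tau)| <= C * (rho1 * l0) `^ (3 - alpha).
  apply: (GE _ rho1 _ lE1 (le_trans half1 r11)).
  by rewrite (ltW t01) gtrBl.
have B0 : `|G (T - tau)| <= C * l0 `^ (3 - alpha).
  rewrite -[l0 in leRHS]mul1r; apply: (GE _ 1 _ _ _).
  - by rewrite lexx gtrBl.
  - by rewrite mul1r /lam opprB addrC subrK.
  - by rewrite ler_pdivrMr// mul1r ler1n.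
have Bs : (rho * l0) `^ (3 - 2 * alpha) / l0 * (`|flux| / 2) <= `|G' s|.
  have sI : T - tau < s < T by rewrite s1/= (lt_trans s2)// gtrBl.
  have rI : 1 - del <= rho <= 1 by rewrite r1.
  exact: (G'E s rho sI lE rI).
have tl : T - kap * tau - (T - tau) = (1 - kap) * tau by ring.
have : `|G' s| * ((1 - kap) * tau) <= C * (l0 `^ (3 - alpha) + (rho1 * l0) `^ (3 - alpha)).
  have k10 : 0 <= (1 - kap) * tau by rewrite ltW// mulr_gt0// subr_gt0.
  rewrite -{1}(ger0_norm k10) -normrM -tl -mvt mulrDr [leRHS]addrC.
  exact: le_trans (ler_normB _ _) (lerD B1 B0).
apply: le_trans.
have k10 : 0 <= (1 - kap) * tau by rewrite ltW// mulr_gt0// subr_gt0.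
apply: le_trans (ler_wpM2r k10 Bs).
by rewrite le_eqVlt; apply/orP; left; apply/eqP; ring.
Qed.

End Momentum.

End WeakLimit.

Unset Implicit Arguments.

Theorem theorem1p3 (R : realType) (m T alpha : R) (v : R -> R3 R -> R3 R)
  (gamma R1 : R) (V : R3 R -> R3 R) :
  5 / 2 < m -> 0 < T -> -1 < alpha ->
  C_sobolev m T v -> euler_classical T v ->
  1 < gamma -> 0 < R1 -> L2loc V ->
  (((T - t) `^ ((alpha - 3 / 2) * (gamma / (alpha + 1))))%:E *
   L2norm (eball R1)
     (fun x : R3 R => v t x -
        ((T - t) `^ (alpha * gamma / (alpha + 1)))^-1 *:
          V (((T - t) `^ (gamma / (alpha + 1)))^-1 *: x))%R)%E
    @[t --> T^'-] --> 0%E ->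
  stationary_euler_weak V.
Proof.
move=> _ T0 alpha1 _ ev gamma1 R10 LV hyp.
have a0 : 0 < alpha + 1 by rewrite -ltrBlDr sub0r.
pose beta := gamma / (alpha + 1).
have b0 : 0 < beta by rewrite divr_gt0// (lt_trans ltr01).
have bg : beta * (alpha + 1) = gamma by rewrite divfK ?gt_eqF.
have hyp' : ((((T - t) `^ beta) `^ (alpha - 3 / 2))%:E * L2norm (eball R1)
     (fun x => v t x - (((T - t) `^ beta) `^ alpha)^-1 *:
        V (((T - t) `^ beta)^-1 *: x))%R)%E @[t --> T^'-] --> 0%E.
  move: hyp; apply: cvg_trans; apply: near_eq_cvg; apply: nearW => t.
  by rewrite -!powRrM -mulrA ![_ * beta]mulrC.
split => //.
  move=> phi [Cphi /compact_supp_box[M [M0 phiM]]] dphi.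
  exact: (weak_momentum T0 b0 R10 ev LV hyp' Cphi M0 phiM gamma1 bg dphi).
by move=> psi Cpsi; exact: (weak_mass T0 b0 R10 ev LV hyp' Cpsi).
Qed.
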